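(* Let $\mathbb{M}=(M_p)_{p\in\mathbb{N}_0}$ be a sequence of positive real numbers with $M_0=1$ which is logarithmically convex, whose sequence of quotients $m_p=M_{p+1}/M_p$ satisfies $\lim_{p\to\infty}m_p=\infty$, and which admits a nonzero proximate order. Let $\gamma>0$, let $G_\gamma$ be a sectorial region with bisecting direction $0$ and opening $\pi\gamma$, and let $\theta\in(-\pi\gamma/2,\pi\gamma/2)$. Suppose $f$ is holomorphic in $G_\gamma$, is bounded in every $T\ll G_\gamma$, and admits $\hat f\in\mathbb{C}[[z]]$ as its $\mathbb{M}$-asymptotic expansion in direction $\theta$. Then $f\in\tilde{\mathcal{A}}_{\mathbb{M}}(G_\gamma)$ and $f\sim_{\mathbb{M}}\hat f$ in $G_\gamma$.
   Context: $\mathbb{N}_0=\{0,1,2,\dots\}$. $\mathcal{R}$ is the Riemann surface of the logarithm (the vertex $0$ does not belong to it; closures are taken in $\mathcal{R}$). For $d\in\mathbb{R}$ and $\gamma,r>0$, $S(d,\gamma,r)=\{z\in\mathcal{R}:|\arg(z)-d|<\pi\gamma/2,\ |z|<r\}$ and $S(d,\gamma)=\{z\in\mathcal{R}:|\arg(z)-d|<\pi\gamma/2\}$. A sectorial region $G_\gamma$ with bisecting direction $0$ and opening $\pi\gamma$ is an open connected set $G_\gamma\subset S(0,\gamma)$ such that for every $\beta\in(0,\gamma)$ there is $\rho=\rho(\beta)>0$ with $S(0,\beta,\rho)\subset G_\gamma$. $T\ll G_\gamma$ means that $T$ is a bounded sector (of the form $S(d',\gamma',r')$) with $\overline{T}\subset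 G_\gamma$ (closure in $\mathcal{R}$). $\mathbb{M}$ is logarithmically convex if $M_p^2\le M_{p-1}M_{p+1}$ for all $p\ge1$. For $t>0$ put $M(t)=\sup_{p\in\mathbb{N}_0}\log(t^p/M_p)$ and, for $t$ large, $d_{\mathbb{M}}(t)=\log(M(t))/\log(t)$. A proximate order is a real function $\rho(r)$ on some $(c,\infty)$, $c\ge0$, such that: (A) $\rho$ is continuous and piecewise continuously differentiable (differentiable except possibly at a sequence of points tending to infinity, at each of which it is continuous and has distinct finite one-sided derivatives); (B) $\rho(r)\ge0$ for all $r>c$; (C) $\lim_{r\to\infty}\rho(r)=\rho<\infty$; (D) $\lim_{r\to\infty}r\rho'(r)\ln r=0$. It is nonzero if the limit $\rho$ in (C) is positive. $\mathbb{M}$ admits a nonzero proximate order if there are a nonzero proximate order $\rho(t)$ and real constants $A,B$ such that $A\le\log(t)\,(\rho(t)-d_{\mathbb{M}}(t))\le B$ for all $t$ large enough. $f$ has $\mathbb{M}$-asymptotic expansion $\hat f=\sum_{n\ge0}a_nz^n$ in direction $\theta$ if there exist $r_\theta,C_\theta,A_\theta>0$ such that the segment $(0,r_\theta e^{i\theta}]$ (points of $\mathcal{R}$ with argument $\theta$ and modulus in $(0,r_\theta]$) is contained in $G_\gamma$ and $|f(z)-\sum_{n=0}^{p-1}a_nz^n|\le C_\theta A_\theta^pM_p|z|^p$ for all $z$ in that segment and all $p\in\mathbb{N}_0$. For $f$ holomorphic in $G_\gamma$, $f\sim_{\mathbb{M}}\hat f=\sum_{n\ge0}a_nz^n$ in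 $G_\gamma$ means: for every $T\ll G_\gamma$ there exist $C_T,A_T>0$ such that $|f(z)-\sum_{n=0}^{p-1}a_nz^n|\le C_TA_T^pM_p|z|^p$ for all $z\in T$ and all $p\in\mathbb{N}_0$. $\tilde{\mathcal{A}}_{\mathbb{M}}(G_\gamma)$ is the space of holomorphic functions in $G_\gamma$ for which such a formal power series exists. *)

(* Defs.v *)
From Stdlib Require Export Reals List.
From Coquelicot Require Export Coquelicot.

Open Scope R_scope.

(* The Riemann surface of the logarithm: the point z is encoded by its global
   logarithmic coordinate (ln |z|, arg z), arg z being an arbitrary real
   number.  Encoding ln |z| rather than |z| leaves the vertex 0 out and makes
   the product topology of R * R the topology of the surface. *)
Definition log_surface : UniformSpace :=
  prod_UniformSpace R_UniformSpace R_UniformSpace.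

Definition modulus (z : log_surface) : R := exp (fst z).
Definition arg (z : log_surface) : R := snd z.

Definition proj (z : log_surface) : C :=
  (modulus z * cos (arg z), modulus z * sin (arg z)).

Definition subset {X : Type} (A B : X -> Prop) : Prop := forall x, A x -> B x.

Definition closure {X : UniformSpace} (A : X -> Prop) (x : X) : Prop :=
  forall U : X -> Prop, locally x U -> exists y, U y /\ A y.

Definition connected {X : UniformSpace} (A : X -> Prop) : Prop :=
  forall U V : X -> Prop, open U -> open V ->
    (forall x, A x -> U x \/ V x) ->
    (exists x, A x /\ U x) -> (exists x, A x /\ V x) ->
    exists x, A x /\ U x /\ V x.

Definition unbounded_sector (d gamma : R) (z : log_surface) : Prop :=
  Rabs (arg z - d) < PI * gamma / 2.

Definition sector (d gamma r : R) (z : log_surface) : Prop :=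
  Rabs (arg z - d) < PI * gamma / 2 /\ modulus z < r.

Definition sectorial_region (gamma : R) (G : log_surface -> Prop) : Prop :=
  open G /\ connected G /\ subset G (unbounded_sector 0 gamma) /\
  forall beta, 0 < beta < gamma ->
    exists rho, 0 < rho /\ subset (sector 0 beta rho) G.

Definition proper_subsector (T G : log_surface -> Prop) : Prop :=
  (exists d gamma r, 0 < gamma /\ 0 < r /\
     forall z, T z <-> sector d gamma r z) /\
  subset (closure T) G.

(* [proj] is a local chart around every point, so this is the existence of the
   complex derivative in that chart. *)
Definition holomorphic_at (f : log_surface -> C) (z : log_surface) : Prop :=
  exists l : C,
    filterlim (fun w => ((f w - f z) / (proj w - proj z))%C)
              (locally' z) (locally l).

Definition holomorphic_on (G : log_surface -> Prop) (f : log_surface -> C) :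
    Prop :=
  forall z, G z -> holomorphic_at f z.

Definition bounded_on (T : log_surface -> Prop) (f : log_surface -> C) : Prop :=
  exists K : R, forall z, T z -> Cmod (f z) <= K.

(* The sum of the terms of index n < p; [sum_n u q] has q + 1 terms. *)
Definition partial_sum (a : nat -> C) (p : nat) (z : C) : C :=
  match p with
  | O => 0%C
  | S q => sum_n (fun n => (a n * z ^ n)%C) q
  end.

Definition remainder_bound (M : nat -> R) (f : log_surface -> C) (a : nat -> C)
    (K A : R) (z : log_surface) : Prop :=
  forall p : nat,
    Cmod (f z - partial_sum a p (proj z))%C
      <= K * A ^ p * M p * modulus z ^ p.

(* A formal power series is given by its sequence of coefficients. *)
Definition asymptotic_in_direction (M : nat -> R) (G : log_surface -> Prop)
    (f : log_surface -> C) (a : nat -> C) (theta : R) : Prop :=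
  exists r K A : R, 0 < r /\ 0 < K /\ 0 < A /\
    forall z, arg z = theta -> modulus z <= r ->
      G z /\ remainder_bound M f a K A z.

Definition asymptotic (M : nat -> R) (G : log_surface -> Prop)
    (f : log_surface -> C) (a : nat -> C) : Prop :=
  forall T, proper_subsector T G ->
    exists K A : R, 0 < K /\ 0 < A /\
      forall z, T z -> remainder_bound M f a K A z.

Definition A_tilde (M : nat -> R) (G : log_surface -> Prop)
    (f : log_surface -> C) : Prop :=
  holomorphic_on G f /\ exists a : nat -> C, asymptotic M G f a.

Definition log_convex (M : nat -> R) : Prop :=
  forall p : nat, (1 <= p)%nat -> M p ^ 2 <= M (p - 1)%nat * M (p + 1)%nat.

Definition quotients (M : nat -> R) (p : nat) : R := M (p + 1)%nat / M p.

(* M(t); the supremum is finite when the quotients of M tend to infinity. *)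
Definition assoc_fun (M : nat -> R) (t : R) : R :=
  real (Sup_seq (fun p => Finite (ln (t ^ p / M p)))).

Definition d_fun (M : nat -> R) (t : R) : R := ln (assoc_fun M t) / ln t.

(* rho : (c, oo) -> R is extended arbitrarily to R.  E is the exceptional set:
   the terms of a (possibly finite or empty) sequence tending to infinity, i.e.
   a set with finitely many points below any bound.  [Derive] has no meaning on
   E, hence the restriction of the last limit to the complement of E. *)
Definition proximate_order (rho : R -> R) (l : R) : Prop :=
  exists (c : R) (E : R -> Prop),
    0 <= c /\
    (forall b, exists s : list R, forall r, c < r <= b -> E r -> In r s) /\
    (forall r, c < r -> continuous rho r) /\
    (forall r, c < r -> ~ E r ->
       ex_derive rho r /\ continuous (Derive rho) r) /\
    (forall r, c < r -> E r ->
       exists l1 l2 : R, l1 <> l2 /\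
         filterlim (fun x => (rho x - rho r) / (x - r))
                   (at_left r) (locally l1) /\
         filterlim (fun x => (rho x - rho r) / (x - r))
                   (at_right r) (locally l2)) /\
    (forall r, c < r -> 0 <= rho r) /\
    is_lim rho p_infty l /\
    filterlim (fun r => r * Derive rho r * ln r)
              (within (fun r => ~ E r) (Rbar_locally p_infty)) (locally 0).

Definition admits_nonzero_proximate_order (M : nat -> R) : Prop :=
  exists (rho : R -> R) (l A B : R),
    proximate_order rho l /\ 0 < l /\
    Rbar_locally p_infty
      (fun t => A <= ln t * (rho t - d_fun M t) <= B).

(* Main.v *)
Require Import Defs.
From Stdlib Require Import Reals Lra Lia List Wf_nat Classical ClassicalEpsilon.
From Coquelicot Require Import Coquelicot.
Open Scope R_scope.

(** In the logarithmic coordinate, let [z] be close to the vertex and let [p] be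
    the index minimising [M n * x ^ n] with [x] a constant multiple of [|z|].
    The remainder [f - partial_sum a p] is bounded on a rectangle of fixed size
    around [z] and at most a multiple of [M p * x ^ p] on the part of the
    direction [theta] in that rectangle.  The two-constants theorem therefore
    bounds it at [z] by a multiple of [(M p * x ^ p) ^ omega], with [omega > 0]
    uniform on the sector.  The proximate order makes [M] of moderate growth, so
    that this power is absorbed by enlarging the constant multiplying [x]; this
    bounds the remainder of index [p] by [M q * (B * x) ^ q] for every [q].
    Passing from the index [p] to the index [q] costs a geometric sum, because
    [M n * x ^ n] decreases up to [p] and increases afterwards. *)

(** * Complex differentiability *)

(** [log_surface] and [C] consist of the same pairs, so a function on the surface is read as a
    function of the complex logarithm of its argument. Dilations and rotations become translations:
    a rectangle of fixed size changes the modulus by at most a fixed factor, whatever the distance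
    to the vertex. Since [p] depends on the point, no single function is estimated on the whole
    sector: each point has its own remainder and its own rectangle, with one side on the line of
    argument [theta].

    The minimal weight at [x] is [exp (- assoc_fun M (1 / x))]. The proximate order says that
    [assoc_fun M t] equals [t^rho(t)] up to constant factors, and since the limit [l] is positive,
    [t^(rho(t) - l/2)] is eventually nondecreasing. Hence [assoc_fun M (t / B) <= omega * assoc_fun
    M t] for [B] and [t] large, which trades the power [omega] for a dilation of [x].

    Away from the vertex the modulus is bounded below, and separate bounds on [f] and on the partial
    sums suffice. *)

Definition Ccontinuous (F : C -> C) (z : C) : Prop :=
  continuous (T := log_surface) (U := R_UniformSpace) (fun w => fst (F w)) z /\
  continuous (T := log_surface) (U := R_UniformSpace) (fun w => snd (F w)) z.

(* Caratheodory's form of complex differentiability: [phi z] is the derivative. *)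
Definition Cdifferentiable (F : C -> C) (z : C) : Prop :=
  exists phi : C -> C, Ccontinuous phi z /\
    locally (T := log_surface) z
      (fun w => (F w - F z = phi w * (w - z))%C).

Lemma continuous_fst_C (z : C) :
  continuous (T := log_surface) (U := R_UniformSpace) (fun w => fst w) z.
Proof. destruct z; apply (continuous_fst (U := R_UniformSpace)). Qed.

Lemma continuous_snd_C (z : C) :
  continuous (T := log_surface) (U := R_UniformSpace) (fun w => snd w) z.
Proof. destruct z; apply (continuous_snd (V := R_UniformSpace)). Qed.

Lemma Ccontinuous_continuous F z :
  Ccontinuous F z <-> continuous (T := log_surface) (U := log_surface) F z.
Proof.
split; [intros [H1 H2] | intros H; split].
- apply filterlim_locally; intros e.
  generalize (filter_and _ _
    (proj1 (filterlim_locally _ _) H1 e) (proj1 (filterlim_locally _ _) H2 e)).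
  apply filter_imp; intros w Hw; exact Hw.
- apply (continuous_comp F (fun w : log_surface => fst w)); [exact H | apply continuous_fst_C].
- apply (continuous_comp F (fun w : log_surface => snd w)); [exact H | apply continuous_snd_C].
Qed.

Lemma Ccontinuous_const c z : Ccontinuous (fun _ => c) z.
Proof. split; apply continuous_const. Qed.

Lemma Ccontinuous_id z : Ccontinuous (fun w => w) z.
Proof. split; [apply continuous_fst_C | apply continuous_snd_C]. Qed.

Lemma Ccontinuous_plus F G z :
  Ccontinuous F z -> Ccontinuous G z ->
  Ccontinuous (fun w => F w + G w)%C z.
Proof.
intros [F1 F2] [G1 G2]; split; simpl.
- exact (continuous_plus _ _ _ F1 G1).
- exact (continuous_plus _ _ _ F2 G2).
Qed.

Lemma Ccontinuous_mult F G z :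
  Ccontinuous F z -> Ccontinuous G z ->
  Ccontinuous (fun w => F w * G w)%C z.
Proof.
intros [F1 F2] [G1 G2]; split; simpl.
- exact (continuous_minus _ _ _ (continuous_mult _ _ _ F1 G1) (continuous_mult _ _ _ F2 G2)).
- exact (continuous_plus _ _ _ (continuous_mult _ _ _ F1 G2) (continuous_mult _ _ _ F2 G1)).
Qed.

Lemma Ccontinuous_comp F G z :
  Ccontinuous G z -> Ccontinuous F (G z) ->
  Ccontinuous (fun w => F (G w)) z.
Proof. rewrite !Ccontinuous_continuous; apply continuous_comp. Qed.

Lemma Ccontinuous_ext_loc F G z :
  locally (T := log_surface) z (fun w => F w = G w) -> Ccontinuous F z -> Ccontinuous G z.
Proof.
intros H [F1 F2]; split.
- refine (continuous_ext_loc _ _ _ _ F1); revert H; apply filter_imp; intros w ->; reflexivity.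
- refine (continuous_ext_loc _ _ _ _ F2); revert H; apply filter_imp; intros w ->; reflexivity.
Qed.

Lemma sum_sqr_neq_0 (x y : R) : (x, y) <> RtoC 0 -> 0 < x * x + y * y.
Proof.
intros H; destruct (Req_dec x 0) as [->|Hx]; [|nra].
destruct (Req_dec y 0) as [->|Hy]; [exfalso; now apply H | nra].
Qed.

Lemma Ccontinuous_inv F z : Ccontinuous F z -> F z <> 0 -> Ccontinuous (fun w => / F w)%C z.
Proof.
intros [F1 F2] Hz.
assert (Hn : 0 < fst (F z) * fst (F z) + snd (F z) * snd (F z)).
{ apply sum_sqr_neq_0; rewrite <- surjective_pairing; exact Hz. }
assert (Hi : continuous (T := log_surface) (U := R_UniformSpace)
   (fun w => / (fst (F w) * fst (F w) + snd (F w) * snd (F w))) z).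
{ apply (continuous_comp (U := log_surface)
    (fun w => fst (F w) * fst (F w) + snd (F w) * snd (F w)) Rinv).
  - exact (continuous_plus _ _ _ (continuous_mult _ _ _ F1 F1) (continuous_mult _ _ _ F2 F2)).
  - apply continuous_Rinv; lra. }
split; unfold Cinv; simpl; unfold Rdiv.
- eapply continuous_ext; [| exact (continuous_mult _ _ _ F1 Hi)].
  intros w; cbv [mult]; simpl; now rewrite !Rmult_1_r.
- eapply continuous_ext;
    [| exact (continuous_mult _ _ _ (continuous_opp _ _ F2) Hi)].
  intros w; cbv [mult opp]; simpl; now rewrite !Rmult_1_r.
Qed.

Lemma Cminus_neq_0 (a b : C) : a <> b -> (a - b)%C <> 0.
Proof.
intros H E; apply H.
replace a with ((a - b) + b)%C by ring; rewrite E; ring.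
Qed.

Lemma Ccontinuous_locally_neq F z c : Ccontinuous F z -> F z <> c ->
  locally (T := log_surface) z (fun w => F w <> c).
Proof.
intros H Hz.
assert (Hd : (F z - c)%C <> 0) by now apply Cminus_neq_0.
assert (Hc : Ccontinuous (fun w => F w + - c)%C z)
  by (apply Ccontinuous_plus; [assumption | apply Ccontinuous_const]).
destruct Hc as [F1 F2].
pose proof (sum_sqr_neq_0 (fst (F z + - c)%C) (snd (F z + - c)%C)) as Hp.
rewrite <- surjective_pairing in Hp; specialize (Hp Hd).
pose proof (proj1 (filterlim_locally _ _)
  (continuous_plus _ _ _ (continuous_mult _ _ _ F1 F1) (continuous_mult _ _ _ F2 F2))
  (mkposreal _ Hp)) as Hl.
revert Hl; apply filter_imp; intros w Hw E; rewrite E in Hw.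
apply (Rlt_irrefl (fst (F z + - c)%C * fst (F z + - c)%C + snd (F z + - c)%C * snd (F z + - c)%C)).
apply Rabs_def2 in Hw; destruct Hw as [_ Hw].
cbv [minus plus mult opp] in Hw; simpl in Hw; simpl; lra.
Qed.

Lemma Cdifferentiable_cont F z : Cdifferentiable F z -> Ccontinuous F z.
Proof.
intros [phi [Hc Hl]].
apply (Ccontinuous_ext_loc (fun w => F z + phi w * (w + - z))%C).
- revert Hl; apply filter_imp; intros w Hw.
  unfold Cminus in Hw; rewrite <- Hw; ring.
- repeat first [apply Ccontinuous_plus | apply Ccontinuous_mult | apply Ccontinuous_id
    | apply Ccontinuous_const | assumption].
Qed.

Lemma Cdifferentiable_const c z : Cdifferentiable (fun _ => c) z.
Proof.
exists (fun _ => 0%C); split; [apply Ccontinuous_const|].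
apply filter_forall; intros w; ring.
Qed.

Lemma Cdifferentiable_id z : Cdifferentiable (fun w => w) z.
Proof.
exists (fun _ => 1%C); split; [apply Ccontinuous_const|].
apply filter_forall; intros w; ring.
Qed.

Lemma Cdifferentiable_plus F G z :
  Cdifferentiable F z -> Cdifferentiable G z ->
  Cdifferentiable (fun w => F w + G w)%C z.
Proof.
intros [phi [Fc Fl]] [psi [Gc Gl]].
exists (fun w => phi w + psi w)%C; split; [now apply Ccontinuous_plus|].
generalize (filter_and _ _ Fl Gl); apply filter_imp; intros w [HF HG].
replace (F w + G w - (F z + G z))%C with ((F w - F z) + (G w - G z))%C by ring.
rewrite HF, HG; ring.
Qed.

Lemma Cdifferentiable_mult F G z :
  Cdifferentiable F z -> Cdifferentiable G z ->
  Cdifferentiable (fun w => F w * G w)%C z.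
Proof.
intros HF0 [psi [Gc Gl]]; pose proof (Cdifferentiable_cont _ _ HF0) as HFc.
destruct HF0 as [phi [Fc Fl]].
exists (fun w => phi w * G z + F w * psi w)%C; split.
- apply Ccontinuous_plus; apply Ccontinuous_mult; try assumption; apply Ccontinuous_const.
- generalize (filter_and _ _ Fl Gl); apply filter_imp; intros w [HF HG].
  replace (F w * G w - F z * G z)%C with ((F w - F z) * G z + F w * (G w - G z))%C by ring.
  rewrite HF, HG; ring.
Qed.

Lemma Cdifferentiable_pow F n z : Cdifferentiable F z -> Cdifferentiable (fun w => F w ^ n)%C z.
Proof.
intros H; induction n as [|n IH].
- exact (Cdifferentiable_const 1%C z).
- exact (Cdifferentiable_mult F _ z H IH).
Qed.

Lemma Cdifferentiable_comp F G z :
  Cdifferentiable G z -> Cdifferentiable F (G z) ->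
  Cdifferentiable (fun w => F (G w)) z.
Proof.
intros HG0 [phi [Fc Fl]]; pose proof (Cdifferentiable_cont _ _ HG0) as HGc.
destruct HG0 as [psi [Gc Gl]].
exists (fun w => phi (G w) * psi w)%C; split.
- apply Ccontinuous_mult; [now apply Ccontinuous_comp | assumption].
- apply Ccontinuous_continuous in HGc.
  assert (Fl' : locally (T := log_surface) z
    (fun w => (F (G w) - F (G z) = phi (G w) * (G w - G z))%C)) by exact (HGc _ Fl).
  generalize (filter_and _ _ Fl' Gl); apply filter_imp; intros w [HF HG].
  rewrite HF, HG; ring.
Qed.

Lemma Cdifferentiable_inv F z : Cdifferentiable F z -> F z <> 0 -> Cdifferentiable (fun w => / F w)%C z.
Proof.
intros HF0 Hz; pose proof (Cdifferentiable_cont _ _ HF0) as HFc.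
destruct HF0 as [phi [Fc Fl]].
exists (fun w => - / F z * (/ F w * phi w))%C; split.
- apply Ccontinuous_mult; [apply Ccontinuous_const|].
  apply Ccontinuous_mult; [now apply Ccontinuous_inv | assumption].
- generalize (filter_and _ _ Fl (Ccontinuous_locally_neq _ _ _ HFc Hz)).
  apply filter_imp; intros w [HF Hw].
  transitivity (- / F z * / F w * (F w - F z))%C; [field; auto | rewrite HF; ring].
Qed.

(** * Goursat's theorem on rectangles *)

(* The real part of the integral of [F z dz] along the boundary of the rectangle
   with corners [(a, c)] and [(b, d)], counterclockwise. *)
Definition contour (F : C -> C) (a b c d : R) : R :=
  RInt (fun x => fst (F (x, c)) - fst (F (x, d))) a b
  - RInt (fun y => snd (F (b, y)) - snd (F (a, y))) c d.

Lemma Ccontinuous_row F x y : Ccontinuous F (x, y) -> continuous (fun t => fst (F (t, y))) x.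
Proof.
intros [H _].
apply (continuous_comp_2 (U := R_UniformSpace) (V := R_UniformSpace) (W := R_UniformSpace)
  (X := R_UniformSpace) (fun t => t) (fun _ => y) (fun u v => fst (F (u, v)))).
- apply continuous_id.
- apply continuous_const.
- eapply continuous_ext; [| exact H]; intros [u v]; reflexivity.
Qed.

Lemma Ccontinuous_col F x y : Ccontinuous F (x, y) -> continuous (fun t => snd (F (x, t))) y.
Proof.
intros [_ H].
apply (continuous_comp_2 (U := R_UniformSpace) (V := R_UniformSpace) (W := R_UniformSpace)
  (X := R_UniformSpace) (fun _ => x) (fun t => t) (fun u v => snd (F (u, v)))).
- apply continuous_const.
- apply continuous_id.
- eapply continuous_ext; [| exact H]; intros [u v]; reflexivity.
Qed.

Lemma ex_RInt_rows F a b c d : a <= b ->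
  (forall x, a <= x <= b -> Ccontinuous F (x, c) /\ Ccontinuous F (x, d)) ->
  ex_RInt (fun x => fst (F (x, c)) - fst (F (x, d))) a b.
Proof.
intros Hab H; apply (ex_RInt_continuous (V := R_CompleteNormedModule)); intros x Hx.
rewrite Rmin_left, Rmax_right in Hx by assumption.
destruct (H x Hx) as [H1 H2].
exact (continuous_minus _ _ _ (Ccontinuous_row _ _ _ H1) (Ccontinuous_row _ _ _ H2)).
Qed.

Lemma ex_RInt_cols F a b c d : c <= d ->
  (forall y, c <= y <= d -> Ccontinuous F (a, y) /\ Ccontinuous F (b, y)) ->
  ex_RInt (fun y => snd (F (b, y)) - snd (F (a, y))) c d.
Proof.
intros Hcd H; apply (ex_RInt_continuous (V := R_CompleteNormedModule)); intros y Hy.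
rewrite Rmin_left, Rmax_right in Hy by assumption.
destruct (H y Hy) as [H1 H2].
exact (continuous_minus _ _ _ (Ccontinuous_col _ _ _ H2) (Ccontinuous_col _ _ _ H1)).
Qed.

Lemma contour_split_x F a m b c d : a <= m <= b -> c <= d ->
  (forall x, a <= x <= b -> Ccontinuous F (x, c) /\ Ccontinuous F (x, d)) ->
  (forall y, c <= y <= d -> Ccontinuous F (a, y) /\ Ccontinuous F (m, y) /\ Ccontinuous F (b, y)) ->
  contour F a b c d = contour F a m c d + contour F m b c d.
Proof.
intros Hm Hcd Hr Hc; unfold contour.
rewrite <- (RInt_Chasles (V := R_CompleteNormedModule)
  (fun x => fst (F (x, c)) - fst (F (x, d))) a m b).
2, 3: apply ex_RInt_rows; [lra | intros x Hx; apply Hr; lra].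
replace (RInt (fun y => snd (F (b, y)) - snd (F (a, y))) c d)
  with (RInt (fun y => snd (F (m, y)) - snd (F (a, y))) c d
        + RInt (fun y => snd (F (b, y)) - snd (F (m, y))) c d).
{ cbv [plus]; simpl; ring. }
rewrite <- (RInt_plus (V := R_CompleteNormedModule)).
2, 3: apply ex_RInt_cols; [lra | intros y Hy; split; apply Hc; lra].
apply RInt_ext; intros y _; cbv [plus]; simpl; ring.
Qed.

Lemma contour_split_y F a b c m d : a <= b -> c <= m <= d ->
  (forall y, c <= y <= d -> Ccontinuous F (a, y) /\ Ccontinuous F (b, y)) ->
  (forall x, a <= x <= b -> Ccontinuous F (x, c) /\ Ccontinuous F (x, m) /\ Ccontinuous F (x, d)) ->
  contour F a b c d = contour F a b c m + contour F a b m d.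
Proof.
intros Hab Hm Hc Hr; unfold contour.
rewrite <- (RInt_Chasles (V := R_CompleteNormedModule)
  (fun y => snd (F (b, y)) - snd (F (a, y))) c m d).
2, 3: apply ex_RInt_cols; [lra | intros y Hy; apply Hc; lra].
replace (RInt (fun x => fst (F (x, c)) - fst (F (x, d))) a b)
  with (RInt (fun x => fst (F (x, c)) - fst (F (x, m))) a b
        + RInt (fun x => fst (F (x, m)) - fst (F (x, d))) a b).
{ cbv [plus]; simpl; ring. }
rewrite <- (RInt_plus (V := R_CompleteNormedModule)).
2, 3: apply ex_RInt_rows; [lra | intros x Hx; split; apply Hr; lra].
apply RInt_ext; intros x _; cbv [plus]; simpl; ring.
Qed.

Lemma RInt_near_const (g : R -> R) a b k e : a <= b -> ex_RInt g a b ->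
  (forall x, a <= x <= b -> Rabs (g x - k) <= e) ->
  Rabs (RInt g a b - (b - a) * k) <= (b - a) * e.
Proof.
intros Hab Hg H.
replace (RInt g a b - (b - a) * k) with (RInt (fun x => g x - k) a b).
- apply abs_RInt_le_const; [assumption | | assumption].
  apply (ex_RInt_minus (V := R_NormedModule)); [assumption | apply ex_RInt_const].
- rewrite (RInt_minus (V := R_CompleteNormedModule)) by (assumption || apply ex_RInt_const).
  rewrite RInt_const; cbv [minus plus opp scal mult]; simpl.
  cbv [mult]; simpl; ring.
Qed.

(* The contour integral of an affine function vanishes. *)
Lemma contour_near_affine F (z0 L : C) e a b c d :
  a <= fst z0 <= b -> c <= snd z0 <= d -> 0 <= e ->
  (forall x y, a <= x <= b -> c <= y <= d -> Ccontinuous F (x, y)) ->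
  (forall x y, a <= x <= b -> c <= y <= d ->
     exists h : C, Rabs (fst h) <= e /\ Rabs (snd h) <= e /\
       (F (x, y) - F z0 = (L + h) * ((x, y) - z0))%C) ->
  Rabs (contour F a b c d) <= 2 * e * ((b - a) + (d - c)) ^ 2.
Proof.
intros Ha Hc He HF HL.
assert (HE : forall x y, a <= x <= b -> c <= y <= d ->
  Rabs (fst (F (x, y)) - (fst (F z0) + fst L * (x - fst z0) - snd L * (y - snd z0)))
    <= e * ((b - a) + (d - c)) /\
  Rabs (snd (F (x, y)) - (snd (F z0) + fst L * (y - snd z0) + snd L * (x - fst z0)))
    <= e * ((b - a) + (d - c))).
{ intros x y Hx Hy; destruct (HL x y Hx Hy) as [[h1 h2] [B1 [B2 E]]]; simpl in B1, B2.
  assert (E1 := f_equal fst E); assert (E2 := f_equal snd E); simpl in E1, E2.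
  assert (D1 : Rabs (x - fst z0) <= b - a) by (apply Rabs_le; lra).
  assert (D2 : Rabs (y - snd z0) <= d - c) by (apply Rabs_le; lra).
  assert (G : forall u v, Rabs u <= e -> Rabs v <= e ->
    Rabs (u * (x - fst z0)) + Rabs (v * (y - snd z0)) <= e * ((b - a) + (d - c))).
  { intros u v Hu Hv; rewrite !Rabs_mult.
    pose proof (Rabs_pos u); pose proof (Rabs_pos v).
    pose proof (Rabs_pos (x - fst z0)); pose proof (Rabs_pos (y - snd z0)).
    rewrite Rmult_plus_distr_l; apply Rplus_le_compat; apply Rmult_le_compat; assumption. }
  split.
  - replace (fst (F (x, y)) - _) with (h1 * (x - fst z0) + - (h2 * (y - snd z0))) by lra.
    eapply Rle_trans; [apply Rabs_triang |]; rewrite Rabs_Ropp; now apply G.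
  - replace (snd (F (x, y)) - _) with (h2 * (x - fst z0) + h1 * (y - snd z0)) by lra.
    eapply Rle_trans; [apply Rabs_triang |]; now apply G. }
assert (I1 : Rabs (RInt (fun x => fst (F (x, c)) - fst (F (x, d))) a b
   - (b - a) * (snd L * (d - c))) <= (b - a) * (2 * (e * ((b - a) + (d - c))))).
{ apply RInt_near_const; [lra | apply ex_RInt_rows; [lra | intros; split; apply HF; lra] |].
  intros x Hx.
  destruct (HE x c Hx ltac:(lra)) as [A1 _]; destruct (HE x d Hx ltac:(lra)) as [A2 _].
  apply Rabs_le_between in A1; apply Rabs_le_between in A2; apply Rabs_le; lra. }
assert (I2 : Rabs (RInt (fun y => snd (F (b, y)) - snd (F (a, y))) c d
   - (d - c) * (snd L * (b - a))) <= (d - c) * (2 * (e * ((b - a) + (d - c))))).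
{ apply RInt_near_const; [lra | apply ex_RInt_cols; [lra | intros; split; apply HF; lra] |].
  intros y Hy.
  destruct (HE a y ltac:(lra) Hy) as [_ A1]; destruct (HE b y ltac:(lra) Hy) as [_ A2].
  apply Rabs_le_between in A1; apply Rabs_le_between in A2; apply Rabs_le; lra. }
unfold contour.
apply Rabs_le_between in I1; apply Rabs_le_between in I2; apply Rabs_le; nra.
Qed.

Lemma pow2_pos n : 0 < 2 ^ n.
Proof. apply pow_lt; lra. Qed.

Lemma bisection_limit (u : nat -> R) (W : R) : 0 <= W ->
  (forall n, u (S n) = u n \/ u (S n) = u n + W / 2 ^ S n) ->
  exists l, forall n, u n <= l <= u n + W / 2 ^ n.
Proof.
intros HW Hu.
assert (Hstep : forall n, u n <= u (S n) /\ u (S n) + W / 2 ^ S n <= u n + W / 2 ^ n).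
{ intros n.
  assert (0 <= W / 2 ^ S n) by (apply Rle_mult_inv_pos; [assumption | apply pow2_pos]).
  assert (W / 2 ^ n = 2 * (W / 2 ^ S n)).
  { simpl; field; pose proof (pow2_pos n); lra. }
  destruct (Hu n); lra. }
assert (Hup : forall n k, u n <= u (k + n)%nat /\ u (k + n)%nat + W / 2 ^ (k + n) <= u n + W / 2 ^ n).
{ intros n k; induction k as [|k IH]; [change (0 + n)%nat with n; lra|].
  change (S k + n)%nat with (S (k + n)); destruct (Hstep (k + n)%nat); lra. }
assert (Hall : forall m n, u m <= u n + W / 2 ^ n).
{ assert (Hpos : forall n, 0 <= W / 2 ^ n)
    by (intros; apply Rle_mult_inv_pos; [assumption | apply pow2_pos]).
  intros m n; destruct (Nat.le_ge_cases m n) as [L|L].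
  - destruct (Hup m (n - m)%nat) as [A _]; replace (n - m + m)%nat with n in A by lia.
    specialize (Hpos n); lra.
  - destruct (Hup n (m - n)%nat) as [_ A]; replace (m - n + n)%nat with m in A by lia.
    specialize (Hpos m); lra. }
destruct (completeness (fun x => exists n, x = u n)) as [l [Hl1 Hl2]].
- exists (u 0%nat + W / 2 ^ 0); intros x [n ->]; apply Hall.
- exists (u 0%nat), 0%nat; reflexivity.
- exists l; intros n; split.
  + apply Hl1; exists n; reflexivity.
  + apply Hl2; intros x [m ->]; apply Hall.
Qed.

(** A compactness principle in the style of Cousin: if the whole rectangle fails [Q], then some
    quarter fails, and the failing quarters shrink to a point around which all small rectangles
    satisfy [Q]. The triple [x y n] stands for the rectangle with lower left corner [(x, y)] and
    sides [W / 2 ^ n] and [H / 2 ^ n]. *)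
Lemma bisection (Q : R -> R -> nat -> Prop) (x0 y0 W H : R) : 0 <= W -> 0 <= H ->
  (forall x y n, x0 <= x -> x + W / 2 ^ n <= x0 + W ->
     y0 <= y -> y + H / 2 ^ n <= y0 + H ->
     Q x y (S n) -> Q (x + W / 2 ^ S n) y (S n) -> Q x (y + H / 2 ^ S n) (S n) ->
     Q (x + W / 2 ^ S n) (y + H / 2 ^ S n) (S n) -> Q x y n) ->
  (forall xl yl, x0 <= xl <= x0 + W -> y0 <= yl <= y0 + H ->
     exists delta, 0 < delta /\ forall x y n,
       x0 <= x -> x + W / 2 ^ n <= x0 + W -> y0 <= y -> y + H / 2 ^ n <= y0 + H ->
       x <= xl <= x + W / 2 ^ n -> y <= yl <= y + H / 2 ^ n ->
       W / 2 ^ n < delta -> H / 2 ^ n < delta -> Q x y n) ->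
  Q x0 y0 0%nat.
Proof.
intros HW HH Hmerge Hloc; apply NNPP; intros HQ.
set (step := fun (n : nat) (p : R * R) =>
  let (x, y) := p in
  if excluded_middle_informative (~ Q x y (S n)) then (x, y)
  else if excluded_middle_informative (~ Q (x + W / 2 ^ S n) y (S n))
    then (x + W / 2 ^ S n, y)
  else if excluded_middle_informative (~ Q x (y + H / 2 ^ S n) (S n))
    then (x, y + H / 2 ^ S n)
  else (x + W / 2 ^ S n, y + H / 2 ^ S n)).
set (p := fix p n := match n with O => (x0, y0) | S n => step n (p n) end).
assert (Hx : forall n, fst (p (S n)) = fst (p n) \/ fst (p (S n)) = fst (p n) + W / 2 ^ S n).
{ intros n; change (p (S n)) with (step n (p n)); unfold step.
  destruct (p n) as [x y]; repeat destruct excluded_middle_informative; simpl; auto. }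
assert (Hy : forall n, snd (p (S n)) = snd (p n) \/ snd (p (S n)) = snd (p n) + H / 2 ^ S n).
{ intros n; change (p (S n)) with (step n (p n)); unfold step.
  destruct (p n) as [x y]; repeat destruct excluded_middle_informative; simpl; auto. }
assert (Hin : forall (u : nat -> R) V, 0 <= V ->
  (forall n, u (S n) = u n \/ u (S n) = u n + V / 2 ^ S n) ->
  forall n, u 0%nat <= u n /\ u n + V / 2 ^ n <= u 0%nat + V).
{ intros u V HV Hu n; induction n as [|n IH]; [simpl; lra|].
  assert (0 <= V / 2 ^ S n) by (apply Rle_mult_inv_pos; [assumption | apply pow2_pos]).
  assert (V / 2 ^ n = 2 * (V / 2 ^ S n)).
  { simpl; field; pose proof (pow2_pos n); lra. }
  destruct (Hu n); lra. }
pose proof (Hin _ _ HW Hx) as Hinx; pose proof (Hin _ _ HH Hy) as Hiny; cbn [p fst snd] in Hinx, Hiny.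
assert (Hbad : forall n, ~ Q (fst (p n)) (snd (p n)) n).
{ induction n as [|n IH]; [exact HQ|].
  pose proof (Hmerge (fst (p n)) (snd (p n)) n (proj1 (Hinx n)) (proj2 (Hinx n))
    (proj1 (Hiny n)) (proj2 (Hiny n))) as Hm.
  change (p (S n)) with (step n (p n)); unfold step.
  destruct (p n) as [x y]; cbn [fst snd] in Hm, IH |- *.
  destruct (excluded_middle_informative (~ Q x y (S n))) as [N|N]; [exact N|].
  destruct (excluded_middle_informative (~ Q (x + W / 2 ^ S n) y (S n))) as [N1|N1]; [exact N1|].
  destruct (excluded_middle_informative (~ Q x (y + H / 2 ^ S n) (S n))) as [N2|N2]; [exact N2|].
  (* The fourth quarter is chosen without a test: if it satisfied [Q] like the other three, so would
     the parent. *)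
  intros N3; apply IH; apply Hm; first [assumption | apply NNPP; assumption]. }
destruct (bisection_limit _ _ HW Hx) as [xl Hxl].
destruct (bisection_limit _ _ HH Hy) as [yl Hyl].
destruct (Hloc xl yl) as [delta [Hd Hs]].
- pose proof (Hxl 0%nat) as A; simpl in A; lra.
- pose proof (Hyl 0%nat) as A; simpl in A; lra.
- assert (exists n, (W + H) / 2 ^ n < delta) as [n Hn].
  { destruct (pow_lt_1_zero (/ 2) ltac:(rewrite Rabs_pos_eq; lra) (delta / (W + H + 1))) as [n Hn].
    { apply Rdiv_lt_0_compat; lra. }
    exists n; specialize (Hn n (le_n n)).
    assert (Hp : 0 < / 2 ^ n) by (apply Rinv_0_lt_compat, pow2_pos).
    rewrite pow_inv, Rabs_pos_eq in Hn by lra.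
    apply (Rmult_lt_compat_r (W + H + 1)) in Hn; [|lra].
    unfold Rdiv in Hn; rewrite Rmult_assoc, Rinv_l, Rmult_1_r in Hn by lra.
    unfold Rdiv; nra. }
  assert (0 <= W / 2 ^ n) by (apply Rle_mult_inv_pos; [assumption | apply pow2_pos]).
  assert (0 <= H / 2 ^ n) by (apply Rle_mult_inv_pos; [assumption | apply pow2_pos]).
  unfold Rdiv in Hn; rewrite Rmult_plus_distr_r in Hn; fold (W / 2 ^ n) (H / 2 ^ n) in Hn.
  apply (Hbad n); apply Hs; try apply Hinx; try apply Hiny; try apply Hxl; try apply Hyl; lra.
Qed.

Lemma goursat F a b c d : a <= b -> c <= d ->
  (forall x y, a <= x <= b -> c <= y <= d -> Cdifferentiable F (x, y)) ->
  contour F a b c d = 0.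
Proof.
intros Hab Hcd HF.
assert (HFc : forall x y, a <= x <= b -> c <= y <= d -> Ccontinuous F (x, y))
  by (intros; now apply Cdifferentiable_cont, HF).
set (W := b - a); set (H := d - c).
assert (HW : 0 <= W) by (unfold W; lra); assert (HH : 0 <= H) by (unfold H; lra).
assert (Hall : forall e, 0 < e -> Rabs (contour F a b c d) <= 2 * e * (W + H) ^ 2).
{ intros e He.
  assert (Hdiv : forall V n, V / 2 ^ n = 2 * (V / 2 ^ S n))
    by (intros V n; simpl; field; pose proof (pow2_pos n); lra).
  assert (Hpos : forall V n, 0 <= V -> 0 <= V / 2 ^ n)
    by (intros V n HV; apply Rle_mult_inv_pos; [assumption | apply pow2_pos]).
  (* The bound is quadratic in the size, so the bounds for four quarters add up to the bound for
     their union; on small rectangles [contour_near_affine] provides exactly such a bound. *)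
  pose proof (bisection (fun x y n => Rabs (contour F x (x + W / 2 ^ n) y (y + H / 2 ^ n))
    <= 2 * e * (W / 2 ^ n + H / 2 ^ n) ^ 2) a c W H HW HH) as HB; cbv beta in HB.
  replace (W / 2 ^ 0) with W in HB by (simpl; field).
  replace (H / 2 ^ 0) with H in HB by (simpl; field).
  replace (a + W) with b in HB by (unfold W; ring).
  replace (c + H) with d in HB by (unfold H; ring).
  apply HB; clear HB.
  - intros x y n Hx1 Hx2 Hy1 Hy2 Q1 Q2 Q3 Q4.
    pose proof (Hpos W (S n) HW) as PW; pose proof (Hpos H (S n) HH) as PH.
    rewrite (Hdiv W n) in *; rewrite (Hdiv H n) in *.
    set (w := W / 2 ^ S n) in *; set (h := H / 2 ^ S n) in *.
    rewrite (contour_split_x F x (x + w) (x + 2 * w)).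
    2, 3: lra.
    2: intros; split; apply HFc; lra.
    2: intros; split; [|split]; apply HFc; lra.
    rewrite (contour_split_y F x (x + w) y (y + h) (y + 2 * h)).
    2, 3: lra.
    2: intros; split; apply HFc; lra.
    2: intros; split; [|split]; apply HFc; lra.
    rewrite (contour_split_y F (x + w) (x + 2 * w) y (y + h) (y + 2 * h)).
    2, 3: lra.
    2: intros; split; apply HFc; lra.
    2: intros; split; [|split]; apply HFc; lra.
    replace (x + w + w) with (x + 2 * w) in * by ring.
    replace (y + h + h) with (y + 2 * h) in * by ring.
    apply Rabs_le_between in Q1; apply Rabs_le_between in Q2.
    apply Rabs_le_between in Q3; apply Rabs_le_between in Q4.
    apply Rabs_le; simpl in *; nra.
  - intros xl yl Hxl Hyl.
    destruct (HF xl yl Hxl Hyl) as [phi [[C1 C2] Hl]].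
    pose proof (proj1 (filterlim_locally _ _) C1 (mkposreal _ He)) as L1.
    pose proof (proj1 (filterlim_locally _ _) C2 (mkposreal _ He)) as L2.
    destruct (filter_and _ _ Hl (filter_and _ _ L1 L2)) as [delta Hd].
    exists delta; split; [apply cond_pos|].
    intros x y n Hx1 Hx2 Hy1 Hy2 Hxn Hyn Hw Hh.
    set (w := W / 2 ^ n) in *; set (h := H / 2 ^ n) in *.
    replace (w + h) with ((x + w - x) + (y + h - y)) by ring.
    apply (contour_near_affine F (xl, yl) (phi (xl, yl))); simpl; try lra.
    + intros; apply HFc; lra.
    + intros x' y' Hx' Hy'.
      destruct (Hd (x', y')) as [E [B1 B2]].
      { split; simpl; apply Rabs_def1; cbv [minus plus opp]; simpl; lra. }
      exists (phi (x', y') - phi (xl, yl))%C; split; [|split].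
      * apply Rlt_le; exact B1.
      * apply Rlt_le; exact B2.
      * rewrite E; ring. }
apply Rabs_eq_0, Rle_antisym; [|apply Rabs_pos].
apply le_epsilon; intros e He; rewrite Rplus_0_l.
(* The summand 1 keeps the divisor positive when the rectangle degenerates to a point. *)
assert (Hp : 0 < 2 * ((W + H) ^ 2 + 1)) by nra.
eapply Rle_trans; [apply (Hall (e / (2 * ((W + H) ^ 2 + 1)))); now apply Rdiv_lt_0_compat|].
assert (0 <= (W + H) ^ 2) by apply pow2_ge_0.
apply Rle_trans with (e / (2 * ((W + H) ^ 2 + 1)) * (2 * ((W + H) ^ 2 + 1))); [|right; field; lra].
assert (0 < e / (2 * ((W + H) ^ 2 + 1))) by now apply Rdiv_lt_0_compat.
nra.
Qed.

(** * The maximum modulus principle *)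

(** At [z0] the value is 0 by default instead of the derivative, so continuity may fail there. The
    contour integral around [z0] is therefore handled by shrinking a square, which only takes
    boundedness near [z0]. *)
Definition diff_quot (F : C -> C) (z0 w : C) : C := ((F w - F z0) * / (w - z0))%C.

Lemma Cdifferentiable_diff_quot F z0 z : z <> z0 -> Cdifferentiable F z -> Cdifferentiable (diff_quot F z0) z.
Proof.
intros Hz HF; unfold diff_quot, Cminus.
apply Cdifferentiable_mult.
- apply Cdifferentiable_plus; [assumption | apply Cdifferentiable_const].
- apply (Cdifferentiable_inv (fun w => w + - z0)%C).
  + apply Cdifferentiable_plus; [apply Cdifferentiable_id | apply Cdifferentiable_const].
  + now apply Cminus_neq_0.
Qed.

Lemma pair_neq_l (x y s t : R) : x <> s -> ((x, y) : C) <> (s, t).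
Proof. intros H E; apply H; congruence. Qed.

Lemma pair_neq_r (x y s t : R) : y <> t -> ((x, y) : C) <> (s, t).
Proof. intros H E; apply H; congruence. Qed.

(** Two vertical and two horizontal cuts leave, besides the small square, four rectangles that avoid
    [(s, t)]; Goursat's theorem removes each of them. *)
Lemma contour_shrink F s t a b c d delta : 0 < delta ->
  a <= s - delta -> s + delta <= b -> c <= t - delta -> t + delta <= d ->
  (forall x y, a <= x <= b -> c <= y <= d -> ((x, y) : C) <> (s, t) -> Cdifferentiable F (x, y)) ->
  contour F a b c d = contour F (s - delta) (s + delta) (t - delta) (t + delta).
Proof.
intros Hd Ha Hb Hc Hdd HF.
assert (HFc : forall x y, a <= x <= b -> c <= y <= d -> x <> s \/ y <> t -> Ccontinuous F (x, y)).
{ intros x y Hx Hy [N|N]; apply Cdifferentiable_cont, HF; auto using pair_neq_l, pair_neq_r. }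
rewrite (contour_split_x F a (s - delta) b c d);
  [ | lra | lra | intros; split; apply HFc; lra | intros; split; [|split]; apply HFc; lra ].
rewrite (contour_split_x F (s - delta) (s + delta) b c d);
  [ | lra | lra | intros; split; apply HFc; lra | intros; split; [|split]; apply HFc; lra ].
rewrite (contour_split_y F (s - delta) (s + delta) c (t - delta) d);
  [ | lra | lra | intros; split; apply HFc; lra | intros; split; [|split]; apply HFc; lra ].
rewrite (contour_split_y F (s - delta) (s + delta) (t - delta) (t + delta) d);
  [ | lra | lra | intros; split; apply HFc; lra | intros; split; [|split]; apply HFc; lra ].
rewrite (goursat F a (s - delta) c d);
  [ | lra | lra | intros; apply HF; try apply pair_neq_l; lra ].
rewrite (goursat F (s + delta) b c d);
  [ | lra | lra | intros; apply HF; try apply pair_neq_l; lra ].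
rewrite (goursat F (s - delta) (s + delta) c (t - delta));
  [ | lra | lra | intros; apply HF; try apply pair_neq_r; lra ].
rewrite (goursat F (s - delta) (s + delta) (t + delta) d);
  [ | lra | lra | intros; apply HF; try apply pair_neq_r; lra ].
ring.
Qed.

(** Near [(s, t)] the quotient coincides with the continuous slope [phi], hence is bounded, while
    the perimeter of the shrinking square tends to 0. *)
Lemma contour_diff_quot F s t a b c d : a < s < b -> c < t < d ->
  (forall x y, a <= x <= b -> c <= y <= d -> Cdifferentiable F (x, y)) ->
  contour (diff_quot F (s, t)) a b c d = 0.
Proof.
intros Hs Ht HF; set (H := diff_quot F (s, t)).
assert (HH : forall x y, a <= x <= b -> c <= y <= d -> ((x, y) : C) <> (s, t) -> Cdifferentiable H (x, y)).
{ intros x y Hx Hy N; apply Cdifferentiable_diff_quot; auto. }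
destruct (HF s t ltac:(lra) ltac:(lra)) as [phi [[C1 C2] Hl]].
pose proof (proj1 (filterlim_locally _ _) C1 (mkposreal _ Rlt_0_1)) as L1.
pose proof (proj1 (filterlim_locally _ _) C2 (mkposreal _ Rlt_0_1)) as L2.
destruct (filter_and _ _ Hl (filter_and _ _ L1 L2)) as [eta Heta].
set (B := Rabs (fst (phi (s, t))) + Rabs (snd (phi (s, t))) + 1).
assert (HB : forall x y, Rabs (x - s) < eta -> Rabs (y - t) < eta -> ((x, y) : C) <> (s, t) ->
  Rabs (fst (H (x, y))) <= B /\ Rabs (snd (H (x, y))) <= B).
{ intros x y Hx Hy N; destruct (Heta (x, y)) as [E [B1 B2]]; [split; assumption|].
  unfold H, diff_quot; rewrite E.
  rewrite <- Cmult_assoc, Cinv_r, Cmult_1_r by now apply Cminus_neq_0.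
  change (Rabs (fst (phi (x, y)) - fst (phi (s, t))) < 1) in B1.
  change (Rabs (snd (phi (x, y)) - snd (phi (s, t))) < 1) in B2.
  pose proof (Rabs_triang_inv (fst (phi (x, y))) (fst (phi (s, t)))).
  pose proof (Rabs_triang_inv (snd (phi (x, y))) (snd (phi (s, t)))).
  pose proof (Rabs_pos (fst (phi (s, t)))); pose proof (Rabs_pos (snd (phi (s, t)))).
  unfold B; lra. }
assert (HB0 : 0 < B).
{ unfold B; pose proof (Rabs_pos (fst (phi (s, t)))); pose proof (Rabs_pos (snd (phi (s, t)))); lra. }
assert (Hsmall : forall delta, 0 < delta -> delta < eta -> delta <= s - a -> delta <= b - s ->
  delta <= t - c -> delta <= d - t -> Rabs (contour H a b c d) <= 8 * B * delta).
{ intros delta D0 D1 D2 D3 D4 D5.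
  rewrite (contour_shrink H s t a b c d delta); try lra; [|assumption].
  assert (HHc : forall x y, s - delta <= x <= s + delta -> t - delta <= y <= t + delta ->
    x <> s \/ y <> t -> Ccontinuous H (x, y)).
  { intros x y Hx Hy [N|N]; apply Cdifferentiable_cont, HH; try lra; auto using pair_neq_l, pair_neq_r. }
  assert (I1 : Rabs (RInt (fun x => fst (H (x, t - delta)) - fst (H (x, t + delta))) (s - delta) (s + delta))
    <= (s + delta - (s - delta)) * (2 * B)).
  { apply abs_RInt_le_const; [lra | apply ex_RInt_rows; [lra|] |].
    - intros x Hx; split; apply HHc; lra.
    - intros x Hx.
      destruct (HB x (t - delta)) as [A1 _];
        [apply Rabs_def1; lra | apply Rabs_def1; lra | apply pair_neq_r; lra |].
      destruct (HB x (t + delta)) as [A2 _];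
        [apply Rabs_def1; lra | apply Rabs_def1; lra | apply pair_neq_r; lra |].
      apply Rabs_le_between in A1; apply Rabs_le_between in A2; apply Rabs_le; lra. }
  assert (I2 : Rabs (RInt (fun y => snd (H (s + delta, y)) - snd (H (s - delta, y))) (t - delta) (t + delta))
    <= (t + delta - (t - delta)) * (2 * B)).
  { apply abs_RInt_le_const; [lra | apply ex_RInt_cols; [lra|] |].
    - intros y Hy; split; apply HHc; lra.
    - intros y Hy.
      destruct (HB (s - delta) y) as [_ A1];
        [apply Rabs_def1; lra | apply Rabs_def1; lra | apply pair_neq_l; lra |].
      destruct (HB (s + delta) y) as [_ A2];
        [apply Rabs_def1; lra | apply Rabs_def1; lra | apply pair_neq_l; lra |].
      apply Rabs_le_between in A1; apply Rabs_le_between in A2; apply Rabs_le; lra. }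
  unfold contour; apply Rabs_le_between in I1; apply Rabs_le_between in I2; apply Rabs_le; lra. }
apply Rabs_eq_0, Rle_antisym; [|apply Rabs_pos].
apply le_epsilon; intros e He; rewrite Rplus_0_l.
set (m := Rmin (Rmin (eta / 2) (e / (8 * B))) (Rmin (Rmin (s - a) (b - s)) (Rmin (t - c) (d - t)))).
assert (E0 : 0 < e / (8 * B)) by (apply Rdiv_lt_0_compat; lra).
pose proof (cond_pos eta) as Hp.
assert (M1 : m <= eta / 2 /\ m <= e / (8 * B) /\ m <= s - a /\ m <= b - s /\ m <= t - c /\ m <= d - t).
{ unfold m; pose proof (Rmin_l (Rmin (eta / 2) (e / (8 * B))) (Rmin (Rmin (s - a) (b - s)) (Rmin (t - c) (d - t)))).
  pose proof (Rmin_r (Rmin (eta / 2) (e / (8 * B))) (Rmin (Rmin (s - a) (b - s)) (Rmin (t - c) (d - t)))).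
  pose proof (Rmin_l (eta / 2) (e / (8 * B))); pose proof (Rmin_r (eta / 2) (e / (8 * B))).
  pose proof (Rmin_l (Rmin (s - a) (b - s)) (Rmin (t - c) (d - t))).
  pose proof (Rmin_r (Rmin (s - a) (b - s)) (Rmin (t - c) (d - t))).
  pose proof (Rmin_l (s - a) (b - s)); pose proof (Rmin_r (s - a) (b - s)).
  pose proof (Rmin_l (t - c) (d - t)); pose proof (Rmin_r (t - c) (d - t)); lra. }
assert (M0 : 0 < m) by (unfold m; repeat apply Rmin_pos; lra).
eapply Rle_trans; [apply (Hsmall m); lra|].
apply Rle_trans with (8 * B * (e / (8 * B))); [|right; field; lra].
apply Rmult_le_compat_l; lra.
Qed.

Lemma im_le_Cmod (z : C) : Rabs (snd z) <= Cmod z.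
Proof. eapply Rle_trans; [apply Rmax_r | apply Rmax_Cmod]. Qed.

Lemma Cmod_le_Rabs (z : C) : Cmod z <= Rabs (fst z) + Rabs (snd z).
Proof.
replace z with (fst z + Ci * snd z)%C at 1.
- eapply Rle_trans; [apply Cmod_triangle|]; rewrite Cmod_mult, Cmod_Ci, !Cmod_R; lra.
- destruct z as [x y]; unfold Cplus, Cmult, Ci, RtoC; simpl; f_equal; ring.
Qed.

(** Up to the positive factor [1 / k], the kernel [i / w] is the pair of the imaginary and the real
    part of [w], whose signs are known on the sides of a rectangle around 0. A perturbation [X] that
    is small compared with the distance to the sides preserves these signs. This takes the place of
    evaluating the winding integral. *)
Lemma kernel_sign (X w : C) D delta : Cmod w <= D -> Cmod X * D < delta -> w <> 0 ->
  let k := (fst w * fst w + snd w * snd w) in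
  0 < k /\
  exists e1 e2, Rabs e1 < delta /\ Rabs e2 < delta /\
  ((- Ci * X - - Ci) * / w)%C = ((snd w + e1) / k, (fst w + e2) / k).
Proof.
intros Hw HX Hn k.
assert (Hk : 0 < k) by (apply sum_sqr_neq_0; rewrite <- surjective_pairing; exact Hn).
split; [exact Hk|].
set (e := (- Ci * X * Cconj w)%C).
assert (He : Cmod e < delta).
{ unfold e; rewrite !Cmod_mult, Cmod_opp, Cmod_Ci, Cmod_conj, Rmult_1_l.
  eapply Rle_lt_trans; [|exact HX]; apply Rmult_le_compat_l; [apply Cmod_ge_0 | assumption]. }
exists (fst e), (snd e); split; [|split].
- eapply Rle_lt_trans; [apply re_le_Cmod | exact He].
- eapply Rle_lt_trans; [apply im_le_Cmod | exact He].
- unfold e, k in *; destruct X as [x1 x2], w as [p r]; simpl in *.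
  unfold Cmult, Cminus, Cplus, Copp, Cinv, Ci, Cconj; simpl.
  f_equal; field; lra.
Qed.

(* Landau's trick: Cauchy's formula for the [n]-th power loses a constant factor
   that disappears as [n] grows. *)
Lemma max_modulus F a b c d K s t : a < s < b -> c < t < d ->
  (forall x y, a <= x <= b -> c <= y <= d -> Cdifferentiable F (x, y)) ->
  (forall x, a <= x <= b -> Cmod (F (x, c)) <= K /\ Cmod (F (x, d)) <= K) ->
  (forall y, c <= y <= d -> Cmod (F (a, y)) <= K /\ Cmod (F (b, y)) <= K) ->
  Cmod (F (s, t)) <= K.
Proof.
intros Hs Ht HF Hrow Hcol; apply Rnot_lt_le; intros HK.
assert (HK0 : 0 <= K).
{ eapply Rle_trans; [apply Cmod_ge_0 | apply (Hrow a); lra]. }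
set (m := Cmod (F (s, t))) in *.
assert (Hz0 : F (s, t) <> 0) by (apply Cmod_gt_0; fold m; lra).
set (D := (b - a) + (d - c)).
set (delta := Rmin (Rmin (s - a) (b - s)) (Rmin (t - c) (d - t))).
assert (Hdel : delta <= s - a /\ delta <= b - s /\ delta <= t - c /\ delta <= d - t).
{ unfold delta.
  pose proof (Rmin_l (Rmin (s - a) (b - s)) (Rmin (t - c) (d - t))).
  pose proof (Rmin_r (Rmin (s - a) (b - s)) (Rmin (t - c) (d - t))).
  pose proof (Rmin_l (s - a) (b - s)); pose proof (Rmin_r (s - a) (b - s)).
  pose proof (Rmin_l (t - c) (d - t)); pose proof (Rmin_r (t - c) (d - t)); lra. }
assert (Hdel0 : 0 < delta) by (unfold delta; repeat apply Rmin_pos; lra).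
assert (HD : 0 < D) by (unfold D; lra).
(* [delta] is the distance from the point to the boundary and [D] exceeds every distance within the
   rectangle. For this [n] the perturbation of the kernel is too small to change its sign on a
   side. *)
destruct (pow_lt_1_zero (K / m)) with (y := delta / D) as [n Hn].
{ rewrite Rabs_pos_eq; [apply (Rmult_lt_reg_r m); [lra|]; unfold Rdiv; rewrite Rmult_assoc, Rinv_l; lra
   | apply Rle_mult_inv_pos; lra]. }
{ apply Rdiv_lt_0_compat; lra. }
specialize (Hn n (le_n n)).
(* The factor [- Ci] moves the residue, which is purely imaginary, into the real part, the only part
   that [contour] records. *)
set (G := fun w => (- Ci * (F w * / F (s, t)) ^ n)%C).
assert (HG : forall x y, a <= x <= b -> c <= y <= d -> Cdifferentiable G (x, y)).
{ intros x y Hx Hy; apply Cdifferentiable_mult; [apply Cdifferentiable_const|].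
  apply Cdifferentiable_pow, Cdifferentiable_mult; [auto | apply Cdifferentiable_const]. }
assert (HG0 : G (s, t) = (- Ci)%C).
{ unfold G; rewrite Cinv_r, Cpow_1_l by assumption; ring. }
assert (Hedge : forall x y, a <= x <= b -> c <= y <= d -> ((x, y) : C) <> (s, t) ->
  Cmod (F (x, y)) <= K ->
  exists k e1 e2, 0 < k /\ Rabs e1 < delta /\ Rabs e2 < delta /\
    diff_quot G (s, t) (x, y) = ((y - t + e1) / k, (x - s + e2) / k)).
{ intros x y Hx Hy N HFK.
  destruct (kernel_sign ((F (x, y) * / F (s, t)) ^ n)%C ((x, y) - (s, t))%C D delta) as [k0 He].
  - eapply Rle_trans; [apply Cmod_le_Rabs|]; simpl; unfold D.
    apply Rplus_le_compat; apply Rabs_le; lra.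
  - rewrite Cmod_pow, Cmod_mult, Cmod_inv by assumption; fold m.
    apply (Rmult_lt_reg_r (/ D)); [now apply Rinv_0_lt_compat|].
    rewrite Rmult_assoc, Rinv_r, Rmult_1_r by lra.
    eapply Rle_lt_trans; [|exact Hn].
    eapply Rle_trans; [|apply Rle_abs].
    apply pow_incr; split.
    + apply Rmult_le_pos; [apply Cmod_ge_0 | left; apply Rinv_0_lt_compat; lra].
    + apply Rmult_le_compat_r; [left; apply Rinv_0_lt_compat; lra | assumption].
  - now apply Cminus_neq_0.
  - destruct He as [e1 [e2 [B1 [B2 E]]]].
    eexists _, e1, e2; split; [exact k0 | split; [exact B1 | split; [exact B2|]]].
    unfold diff_quot; rewrite HG0; exact E. }
pose proof (contour_diff_quot G s t a b c d Hs Ht HG) as H0.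
set (H := diff_quot G (s, t)) in *.
assert (HHc : forall x y, a <= x <= b -> c <= y <= d -> ((x, y) : C) <> (s, t) -> Ccontinuous H (x, y)).
{ intros x y Hx Hy N; apply Cdifferentiable_cont, Cdifferentiable_diff_quot; auto. }
unfold contour in H0.
(* The real part of [H] has the sign of [y - t] on the horizontal sides, the imaginary part that of
   [x - s] on the vertical ones. Both integrals thus contribute negatively to a contour integral
   that vanishes. *)
assert (I1 : 0 < RInt (fun x => - (fst (H (x, c)) - fst (H (x, d)))) a b).
{ apply RInt_gt_0; [lra | |].
  - intros x Hx.
    destruct (Hedge x c) as [k [e1 [e2 [P0 [P1 [P2 ->]]]]]];
      [lra | lra | apply pair_neq_r; lra | apply Hrow; lra |].
    destruct (Hedge x d) as [k' [e1' [e2' [P0' [P1' [P2' ->]]]]]];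
      [lra | lra | apply pair_neq_r; lra | apply Hrow; lra |].
    simpl; apply Rabs_def2 in P1; apply Rabs_def2 in P1'.
    assert (0 < - (c - t + e1) / k) by (apply Rdiv_lt_0_compat; lra).
    assert (0 < (d - t + e1') / k') by (apply Rdiv_lt_0_compat; lra).
    unfold Rdiv in *; lra.
  - intros x Hx; apply (continuous_opp (V := R_NormedModule)).
    apply (continuous_minus (V := R_NormedModule)); apply Ccontinuous_row, HHc;
      solve [lra | apply pair_neq_r; lra]. }
assert (I2 : 0 < RInt (fun y => snd (H (b, y)) - snd (H (a, y))) c d).
{ apply RInt_gt_0; [lra | |].
  - intros y Hy.
    destruct (Hedge a y) as [k [e1 [e2 [P0 [P1 [P2 ->]]]]]];
      [lra | lra | apply pair_neq_l; lra | apply Hcol; lra |].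
    destruct (Hedge b y) as [k' [e1' [e2' [P0' [P1' [P2' ->]]]]]];
      [lra | lra | apply pair_neq_l; lra | apply Hcol; lra |].
    simpl; apply Rabs_def2 in P2; apply Rabs_def2 in P2'.
    assert (0 < - (a - s + e2) / k) by (apply Rdiv_lt_0_compat; lra).
    assert (0 < (b - s + e2') / k') by (apply Rdiv_lt_0_compat; lra).
    unfold Rdiv in *; lra.
  - intros y Hy; apply (continuous_minus (V := R_NormedModule)); apply Ccontinuous_col, HHc;
      solve [lra | apply pair_neq_l; lra]. }
rewrite (RInt_opp (V := R_CompleteNormedModule)) in I1.
- match type of I1 with 0 < opp ?v => change (0 < - v) in I1 end; lra.
- apply ex_RInt_rows; [lra|]; intros x Hx; split; apply HHc; solve [lra | apply pair_neq_r; lra].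
Qed.

(** * The complex exponential *)

Lemma Ccontinuous_Cmod F z :
  (forall e, 0 < e -> locally (T := log_surface) z (fun w => Cmod (F w - F z) < e)) -> Ccontinuous F z.
Proof.
intros H; split; apply filterlim_locally; intros e; generalize (H e (cond_pos e));
  apply filter_imp; intros w Hw.
- eapply Rle_lt_trans; [apply (re_le_Cmod (F w - F z)%C) | exact Hw].
- eapply Rle_lt_trans; [apply (im_le_Cmod (F w - F z)%C) | exact Hw].
Qed.

Lemma derivative_slope F z L :
  (forall e, 0 < e -> locally (T := log_surface) z
     (fun w => Cmod (F w - F z - L * (w - z)) <= e * Cmod (w - z))) ->
  exists phi, Ccontinuous phi z /\ phi z = L /\
    forall w, (F w - F z = phi w * (w - z))%C.
Proof.
intros H; set (phi := fun w => (L + (F w - F z - L * (w - z)) * / (w - z))%C).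
(* At [w = z] the numerator vanishes, so the value given to the inverse of 0 is multiplied by 0. *)
assert (Hz : phi z = L) by (unfold phi; ring).
exists phi; split; [|split; [exact Hz|]].
- apply Ccontinuous_Cmod; intros e He.
  generalize (H (e / 2) ltac:(lra)); apply filter_imp; intros w Hw; rewrite Hz.
  destruct (classic (w = z)) as [->|N].
  + rewrite Hz; replace (L - L)%C with (RtoC 0) by ring; rewrite Cmod_0; exact He.
  + assert (N' : (w - z)%C <> 0) by now apply Cminus_neq_0.
    replace (phi w - L)%C with ((F w - F z - L * (w - z)) / (w - z))%C by (unfold phi, Cdiv; ring).
    rewrite Cmod_div by assumption.
    apply Cmod_gt_0 in N'.
    apply Rle_lt_trans with (e / 2); [|lra].
    apply (Rmult_le_reg_r (Cmod (w - z))); [assumption|].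
    unfold Rdiv at 1; rewrite Rmult_assoc, Rinv_l by lra; lra.
- intros w; destruct (classic (w = z)) as [->|N]; [ring|].
  unfold phi; field; now apply Cminus_neq_0.
Qed.

Lemma first_order f l : derivable_pt_lim f 0 l -> forall e, 0 < e ->
  exists delta, 0 < delta /\ forall h, Rabs h < delta ->
    Rabs (f h - f 0 - l * h) <= e * Rabs h.
Proof.
intros H e He; destruct (H e He) as [delta Hd]; exists delta; split; [apply cond_pos|].
intros h Hh; destruct (Req_dec h 0) as [->|N].
- replace (f 0 - f 0 - l * 0) with 0 by ring; rewrite Rabs_R0; lra.
- specialize (Hd h N Hh); rewrite Rplus_0_l in Hd.
  replace (f h - f 0 - l * h) with (((f h - f 0) / h - l) * h) by (field; assumption).
  rewrite Rabs_mult; apply Rmult_le_compat_r; [apply Rabs_pos | lra].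
Qed.

Lemma proj_plus (z w : C) : proj (z + w)%C = (proj z * proj w)%C.
Proof.
destruct z as [x y], w as [u v]; unfold proj, modulus, arg, Cplus, Cmult; simpl.
rewrite exp_plus, cos_plus, sin_plus; f_equal; ring.
Qed.

Lemma Cmod_proj (z : C) : Cmod (proj z) = exp (fst z).
Proof.
destruct z as [x y]; unfold Cmod, proj, modulus, arg; simpl.
replace (_ + _) with ((exp x) ^ 2 * (Rsqr (sin y) + Rsqr (cos y))) by (unfold Rsqr; ring).
rewrite sin2_cos2, Rmult_1_r; apply sqrt_pow2; left; apply exp_pos.
Qed.

Lemma proj_neq_0 (z : C) : proj z <> 0.
Proof. apply Cmod_gt_0; rewrite Cmod_proj; apply exp_pos. Qed.

Lemma proj_first_order e : 0 < e -> exists delta, 0 < delta /\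
  forall h : C, Rabs (fst h) < delta -> Rabs (snd h) < delta ->
    Cmod (proj h - 1 - h) <= e * Cmod h.
Proof.
(* The two components of the error are at most [4 * e' * m] and [5 * e' * m], so any fraction of [e]
   up to one ninth would do; the bound [e' <= 1] keeps [exp x] below 3. *)
intros He0; set (e' := Rmin (e / 16) 1).
assert (He : 0 < e') by (apply Rmin_pos; lra).
assert (He1 : e' <= 1) by apply Rmin_r.
assert (He2 : e' <= e / 16) by apply Rmin_l.
destruct (first_order exp 1 derivable_pt_lim_exp_0 e' He) as [d1 [P1 H1]].
destruct (first_order cos 0) with (e := e') as [d2 [P2 H2]]; [|assumption|].
{ pose proof (derivable_pt_lim_cos 0) as D; rewrite sin_0, Ropp_0 in D; exact D. }
destruct (first_order sin 1) with (e := e') as [d3 [P3 H3]]; [|assumption|].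
{ pose proof (derivable_pt_lim_sin 0) as D; rewrite cos_0 in D; exact D. }
exists (Rmin (Rmin d1 d2) (Rmin d3 e')); split; [repeat apply Rmin_pos; lra|].
intros [x y]; simpl fst; simpl snd; intros Hx Hy.
assert (Hm : forall r, r < Rmin (Rmin d1 d2) (Rmin d3 e') -> r < d1 /\ r < d2 /\ r < d3 /\ r < e').
{ intros r Hr.
  pose proof (Rmin_l (Rmin d1 d2) (Rmin d3 e')); pose proof (Rmin_r (Rmin d1 d2) (Rmin d3 e')).
  pose proof (Rmin_l d1 d2); pose proof (Rmin_r d1 d2).
  pose proof (Rmin_l d3 e'); pose proof (Rmin_r d3 e'); lra. }
apply Hm in Hx; apply Hm in Hy.
specialize (H1 x ltac:(lra)); specialize (H2 y ltac:(lra)); specialize (H3 y ltac:(lra)).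
rewrite exp_0, Rmult_1_l in H1; rewrite cos_0, Rmult_0_l, Rminus_0_r in H2.
rewrite sin_0, Rmult_1_l, Rminus_0_r in H3.
pose proof (re_le_Cmod (x, y)) as Mx; pose proof (im_le_Cmod (x, y)) as My; simpl in Mx, My.
set (m := Cmod (x, y)) in *.
eapply Rle_trans; [apply Cmod_le_Rabs|]; unfold proj, modulus, arg; simpl.
pose proof (Rabs_pos x) as Ax; pose proof (Rabs_pos y) as Ay.
assert (A1 : Rabs (exp x - 1) <= 2 * e').
{ replace (exp x - 1) with ((exp x - 1 - x) + x) by ring.
  eapply Rle_trans; [apply Rabs_triang|]; nra. }
assert (A2 : Rabs (exp x) <= 3).
{ replace (exp x) with ((exp x - 1) + 1) by ring.
  eapply Rle_trans; [apply Rabs_triang|]; rewrite Rabs_R1; lra. }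
assert (A3 : Rabs (cos y) <= 1) by (apply Rabs_le, COS_bound).
assert (B1 : Rabs (exp x * cos y + - (1) + - x) <= 4 * e' * m).
{ replace (exp x * cos y + - (1) + - x) with ((exp x - 1 - x) + exp x * (cos y - 1)) by ring.
  eapply Rle_trans; [apply Rabs_triang|]; rewrite Rabs_mult.
  assert (Rabs (exp x) * Rabs (cos y - 1) <= 3 * (e' * Rabs y))
    by (apply Rmult_le_compat; (apply Rabs_pos || assumption)).
  nra. }
assert (B2 : Rabs (exp x * sin y + - 0 + - y) <= 5 * e' * m).
{ replace (exp x * sin y + - 0 + - y) with (exp x * (sin y - y) + (exp x - 1) * y) by ring.
  eapply Rle_trans; [apply Rabs_triang|]; rewrite !Rabs_mult.
  assert (Rabs (exp x) * Rabs (sin y - y) <= 3 * (e' * Rabs y))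
    by (apply Rmult_le_compat; (apply Rabs_pos || assumption)).
  assert (Rabs (exp x - 1) * Rabs y <= 2 * e' * Rabs y)
    by (apply Rmult_le_compat_r; assumption).
  nra. }
nra.
Qed.

Lemma proj_slope z : exists phi, Ccontinuous phi z /\ phi z = proj z /\
  forall w : C, (proj w - proj z = phi w * (w - z))%C.
Proof.
apply derivative_slope; intros e He.
assert (Hp := exp_pos (fst z)).
destruct (proj_first_order (e / exp (fst z))) as [delta [Hd H]]; [now apply Rdiv_lt_0_compat|].
exists (mkposreal _ Hd); intros w [B1 B2].
replace (proj w - proj z - proj z * (w - z))%C with (proj z * (proj (w - z)%C - 1 - (w - z)))%C.
- rewrite Cmod_mult, Cmod_proj.
  apply Rle_trans with (exp (fst z) * (e / exp (fst z) * Cmod (w - z))).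
  + apply Rmult_le_compat_l; [lra|]; apply H; [exact B1 | exact B2].
  + right; field; lra.
- replace (proj w) with (proj (z + (w - z))%C) by (f_equal; ring).
  rewrite proj_plus; ring.
Qed.

Lemma Cdifferentiable_proj z : Cdifferentiable proj z.
Proof.
destruct (proj_slope z) as [phi [H1 [_ H2]]]; exists phi; split; [assumption|].
now apply filter_forall.
Qed.

(** The chain rule for [f] seen through the chart [proj]. The slope of [proj] tends to [proj z],
    which is not 0, so [proj w] differs from [proj z] for [w] near [z] and distinct from it; the
    quotients that define holomorphy are then genuine ones. *)
Lemma holomorphic_at_Cdifferentiable f z : holomorphic_at f z -> Cdifferentiable f z.
Proof.
intros [l Hl]; destruct (proj_slope z) as [phi [Hc [Hz Hphi]]].
set (psi := fun w : C => if excluded_middle_informative (w = z) then l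
  else ((f w - f z) / (proj w - proj z))%C).
assert (Hpz : psi z = l) by (unfold psi; destruct excluded_middle_informative; tauto).
assert (Hpsi : Ccontinuous psi z).
{ apply Ccontinuous_continuous, filterlim_locally; intros e; rewrite Hpz.
  generalize (proj1 (filterlim_locally _ _) Hl e); unfold locally', within.
  apply filter_imp; intros w Hw; unfold psi; destruct excluded_middle_informative as [E|N].
  - apply ball_center.
  - exact (Hw N). }
exists (fun w => psi w * phi w)%C; split; [now apply Ccontinuous_mult|].
assert (Hn : phi z <> 0) by (rewrite Hz; apply proj_neq_0).
generalize (Ccontinuous_locally_neq _ _ _ Hc Hn); apply filter_imp; intros w Hw.
rewrite <- Cmult_assoc, <- Hphi; unfold psi.
destruct excluded_middle_informative as [->|N]; [ring|].
field; rewrite Hphi; apply Cmult_neq_0; [exact Hw | now apply Cminus_neq_0].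
Qed.

(** * The two-constants theorem *)

Lemma exp_nondecreasing x y : x <= y -> exp x <= exp y.
Proof.
intros [H| ->]; [left; now apply exp_increasing | right; reflexivity].
Qed.

(* With [x + i y = w - (u + i v)] and [t = y / e], the real part of [barrier] is
   the harmonic function [1 - t - x^2 / (4 e^2) - t (1 - t) / 4].  On the
   rectangle [|x| <= 2 |e|], [0 <= t <= 1] it is a lower bound for the harmonic
   measure of the side [t = 0]. *)
Definition barrier (u v e : R) (w : C) : C :=
  (1 + RtoC (/ e + / (4 * e)) * Ci * (w - (u, v))
   - RtoC (/ (4 * e ^ 2)) * ((w - (u, v)) * (w - (u, v))))%C.

Lemma barrier_re u v e x t : e <> 0 ->
  fst (barrier u v e (x, v + e * t)) = 1 - t - (x - u) ^ 2 / (4 * e ^ 2) - t * (1 - t) / 4.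
Proof.
intros He; unfold barrier, Cminus, Cplus, Cmult, Copp, Ci, RtoC; simpl; field; exact He.
Qed.

Lemma Cdifferentiable_barrier u v e lambda z : Cdifferentiable (fun w => RtoC lambda * barrier u v e w)%C z.
Proof.
unfold barrier, Cminus.
assert (H : Cdifferentiable (fun w => w + - (u, v))%C z)
  by (apply Cdifferentiable_plus; [apply Cdifferentiable_id | apply Cdifferentiable_const]).
apply Cdifferentiable_mult; [apply Cdifferentiable_const|].
apply Cdifferentiable_plus; [apply Cdifferentiable_plus|]; [apply Cdifferentiable_const | |].
- apply Cdifferentiable_mult; [apply Cdifferentiable_const | exact H].
- apply (Cdifferentiable_comp (fun w => - w)%C).
  + apply Cdifferentiable_mult; [apply Cdifferentiable_const | apply Cdifferentiable_mult; exact H].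
  + exists (fun _ => - (1))%C; split; [apply Ccontinuous_const|].
    apply filter_forall; intros w; ring.
Qed.

(** Multiplying [F] by the exponential of [lambda] times the barrier, with [lambda = - ln eta],
    brings all four sides to the level [K]: the factor is at most [1 / eta] on the side where [F] is
    small and at most 1 on the others. The maximum principle then applies to the product. The
    constant [3 / 4] comes from the value [(1 - t) (1 - t / 4)] of the barrier on the axis. A
    negative [e] puts the rectangle below the line of height [v]. *)
Lemma two_constants F u v e K eta : e <> 0 -> 0 < eta <= 1 ->
  (forall x t, Rabs (x - u) <= 2 * Rabs e -> 0 <= t <= 1 ->
     Cdifferentiable F (x, v + e * t) /\ Cmod (F (x, v + e * t)) <= K) ->
  (forall x, Rabs (x - u) <= 2 * Rabs e -> Cmod (F (x, v)) <= K * eta) ->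
  forall t, 0 <= t <= 1 -> Cmod (F (u, v + e * t)) <= K * exp (3 / 4 * (1 - t) * ln eta).
Proof.
intros He Heta HF Hray t Ht.
assert (Ha : 0 < Rabs e) by now apply Rabs_pos_lt.
assert (He2 : 0 < e ^ 2) by (rewrite <- pow2_abs; nra).
set (lambda := - ln eta).
assert (Hl : 0 <= lambda).
{ unfold lambda; rewrite <- Ropp_0, <- ln_1; apply Ropp_le_contravar, ln_le; lra. }
assert (HK : 0 <= K).
{ eapply Rle_trans; [apply Cmod_ge_0 | apply (HF u 0); [rewrite Rminus_diag, Rabs_R0; lra | lra]]. }
set (H := fun w => (F w * proj (RtoC lambda * barrier u v e w)%C)%C).
assert (Hmod : forall x s, Cmod (H (x, v + e * s)) =
  Cmod (F (x, v + e * s)) * exp (lambda * (1 - s - (x - u) ^ 2 / (4 * e ^ 2) - s * (1 - s) / 4))).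
{ intros x s; unfold H; rewrite Cmod_mult, Cmod_proj; do 2 f_equal.
  rewrite <- (barrier_re u v e x s He); unfold Cmult, RtoC; simpl; ring. }
assert (HdH : forall x s, Rabs (x - u) <= 2 * Rabs e -> 0 <= s <= 1 -> Cdifferentiable H (x, v + e * s)).
{ intros x s Hx Hs; apply Cdifferentiable_mult; [now apply HF|].
  apply (Cdifferentiable_comp proj); [apply Cdifferentiable_barrier | apply Cdifferentiable_proj]. }
assert (Hsq : forall x, 0 <= (x - u) ^ 2 / (4 * e ^ 2))
  by (intros x; apply Rle_mult_inv_pos; [apply pow2_ge_0 | lra]).
assert (Hcut : forall k r, 0 <= k <= K -> r <= 0 -> k * exp (lambda * r) <= K).
{ intros k r Hk Hr; rewrite <- (Rmult_1_r K).
  apply Rmult_le_compat; [lra | left; apply exp_pos | lra |].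
  rewrite <- exp_0; apply exp_nondecreasing; nra. }
assert (Hbot : forall x, Rabs (x - u) <= 2 * Rabs e -> Cmod (H (x, v)) <= K).
{ intros x Hx; pose proof (Hmod x 0) as E; rewrite Rmult_0_r, Rplus_0_r in E; rewrite E.
  apply Rle_trans with (K * eta * exp lambda).
  - apply Rmult_le_compat; [apply Cmod_ge_0 | left; apply exp_pos | now apply Hray |].
    apply exp_nondecreasing; specialize (Hsq x); nra.
  - unfold lambda; rewrite exp_Ropp, exp_ln by lra; right; field; lra. }
assert (Htop : forall x, Rabs (x - u) <= 2 * Rabs e -> Cmod (H (x, v + e)) <= K).
{ intros x Hx; pose proof (Hmod x 1) as E; rewrite Rmult_1_r in E; rewrite E.
  apply Hcut; [split; [apply Cmod_ge_0|] | specialize (Hsq x); lra].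
  destruct (HF x 1 Hx ltac:(lra)) as [_ A]; rewrite Rmult_1_r in A; exact A. }
assert (Hside : forall x s, Rabs (x - u) = 2 * Rabs e -> 0 <= s <= 1 ->
  Cmod (H (x, v + e * s)) <= K).
{ intros x s Hx Hs; rewrite Hmod; apply Hcut.
  - split; [apply Cmod_ge_0 | apply HF; lra].
  - replace ((x - u) ^ 2 / (4 * e ^ 2)) with 1; [nra|].
    rewrite <- (pow2_abs (x - u)), Hx, Rpow_mult_distr, pow2_abs; field; exact He. }
assert (Hmax : 0 < t < 1 -> Cmod (H (u, v + e * t)) <= K).
{ intros Ht'.
  assert (Hy : forall y, v + e * ((y - v) / e) = y) by (intros; field; exact He).
  assert (Hx : forall x, u - 2 * Rabs e <= x <= u + 2 * Rabs e -> Rabs (x - u) <= 2 * Rabs e)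
    by (intros; apply Rabs_le; lra).
  assert (Hx1 : Rabs (u - 2 * Rabs e - u) = 2 * Rabs e).
  { replace (u - 2 * Rabs e - u) with (- (2 * Rabs e)) by ring.
    rewrite Rabs_Ropp; apply Rabs_pos_eq; lra. }
  assert (Hx2 : Rabs (u + 2 * Rabs e - u) = 2 * Rabs e).
  { replace (u + 2 * Rabs e - u) with (2 * Rabs e) by ring; apply Rabs_pos_eq; lra. }
  destruct (Rle_lt_dec 0 e) as [E|E].
  - assert (P : 0 < e) by lra.
    assert (Hs : forall y, v <= y <= v + e -> 0 <= (y - v) / e <= 1).
    { intros y Hyy; split; [apply Rle_mult_inv_pos; lra|].
      apply (Rmult_le_reg_r e); [lra|]; unfold Rdiv; rewrite Rmult_assoc, Rinv_l; lra. }
    apply (max_modulus H (u - 2 * Rabs e) (u + 2 * Rabs e) v (v + e) K); [lra | split; nra | | |].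
    + intros x y Hxx Hyy; rewrite <- (Hy y); apply HdH; auto.
    + intros x Hxx; split; [apply Hbot | apply Htop]; auto.
    + intros y Hyy; rewrite <- (Hy y); split; apply Hside; auto.
  - assert (Hs : forall y, v + e <= y <= v -> 0 <= (y - v) / e <= 1).
    { intros y Hyy; replace ((y - v) / e) with ((v - y) / - e) by (field; lra).
      split; [apply Rle_mult_inv_pos; lra|].
      apply (Rmult_le_reg_r (- e)); [lra|]; unfold Rdiv; rewrite Rmult_assoc, Rinv_l; lra. }
    apply (max_modulus H (u - 2 * Rabs e) (u + 2 * Rabs e) (v + e) v K); [lra | split; nra | | |].
    + intros x y Hxx Hyy; rewrite <- (Hy y); apply HdH; auto.
    + intros x Hxx; split; [apply Htop | apply Hbot]; auto.
    + intros y Hyy; rewrite <- (Hy y); split; apply Hside; auto. }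
assert (Hu : Rabs (u - u) <= 2 * Rabs e) by (rewrite Rminus_diag, Rabs_R0; lra).
assert (HKt : Cmod (H (u, v + e * t)) <= K).
{ destruct (Req_dec t 0) as [->|N0]; [rewrite Rmult_0_r, Rplus_0_r; now apply Hbot|].
  destruct (Req_dec t 1) as [->|N1]; [rewrite Rmult_1_r; now apply Htop|].
  apply Hmax; lra. }
rewrite Hmod in HKt.
replace ((u - u) ^ 2 / (4 * e ^ 2)) with 0 in HKt by (field; exact He).
replace (3 / 4 * (1 - t) * ln eta) with (- (lambda * (3 / 4 * (1 - t)))) by (unfold lambda; ring).
rewrite exp_Ropp.
apply (Rmult_le_reg_r (exp (lambda * (3 / 4 * (1 - t))))); [apply exp_pos|].
rewrite Rmult_assoc, Rinv_l, Rmult_1_r by (apply Rgt_not_eq, exp_pos).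
eapply Rle_trans; [|exact HKt].
apply Rmult_le_compat_l; [apply Cmod_ge_0|]; apply exp_nondecreasing.
apply Rmult_le_compat_l; [exact Hl | nra].
Qed.

(** * Moderate growth *)

Lemma nondecreasing_except_finite (s : list R) (V : R -> R) a b : a <= b ->
  (forall x, a <= x <= b -> continuous V x) ->
  (forall x, a < x < b -> ~ In x s -> exists d, is_derive V x d /\ 0 <= d) ->
  V a <= V b.
Proof.
revert a b; induction s as [|h s IH]; intros a b Hab Hc Hd.
(* The mean value point may be an endpoint, where no derivative is assumed; the value 0 chosen there
   has the right sign. *)
- destruct (MVT_gen V a b (fun x => if excluded_middle_informative (a < x < b)
    then Derive V x else 0)) as [x [_ E]].
  + intros x Hx; rewrite Rmin_left, Rmax_right in Hx by assumption.
    destruct (Hd x Hx (fun H => H)) as [d [D _]].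
    destruct excluded_middle_informative; [|tauto].
    apply Derive_correct; now exists d.
  + intros x Hx; rewrite Rmin_left, Rmax_right in Hx by assumption.
    apply continuity_pt_filterlim; now apply Hc.
  + destruct excluded_middle_informative as [Hx|_]; [|lra].
    destruct (Hd x Hx (fun H => H)) as [d [D D0]].
    rewrite (is_derive_unique _ _ _ D) in E; nra.
- destruct (classic (a < h < b)) as [Hh|Hh].
  + apply Rle_trans with (V h); apply IH; try lra.
    * intros x Hx; apply Hc; lra.
    * intros x Hx N; apply Hd; [lra|]; intros [E|E]; [lra | tauto].
    * intros x Hx; apply Hc; lra.
    * intros x Hx N; apply Hd; [lra|]; intros [E|E]; [lra | tauto].
  + apply IH; [assumption | assumption |].
    intros x Hx N; apply Hd; [assumption|]; intros [E|E]; [subst; tauto | tauto].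
Qed.

(** The derivative of [(rho x - l / 2) * ln x], multiplied by [x], is
    [x * rho' * ln x + rho - l / 2]. It is eventually at least [- l / 4 + 3 * l / 4 - l / 2 = 0],
    which explains the two thresholds below. *)
Lemma proximate_order_growth rho l : proximate_order rho l -> 0 < l ->
  exists t1, 1 <= t1 /\ forall a b, t1 <= a <= b ->
    l / 2 * (ln b - ln a) <= rho b * ln b - rho a * ln a.
Proof.
intros [c [E [Hc [HE [Hcont [Hder [_ [_ [Hlim Hlim']]]]]]]]] Hl.
assert (L1 : Rbar_locally p_infty (fun t => 3 / 4 * l < rho t)).
{ assert (He : 0 < l / 4) by lra.
  generalize (proj1 (filterlim_locally _ _) Hlim (mkposreal _ He)).
  apply filter_imp; intros t Ht; apply Rabs_def2 in Ht.
  cbv [minus plus opp] in Ht; simpl in Ht; lra. }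
assert (L2 : Rbar_locally p_infty (fun t => ~ E t -> - (l / 4) < t * Derive rho t * ln t)).
{ assert (He : 0 < l / 4) by lra.
  generalize (proj1 (filterlim_locally _ _) Hlim' (mkposreal _ He)); unfold within.
  apply filter_imp; intros t Ht N; specialize (Ht N); apply Rabs_def2 in Ht.
  cbv [minus plus opp] in Ht; simpl in Ht; lra. }
destruct (filter_and _ _ L1 L2) as [T HT].
exists (Rmax 1 (Rmax (c + 1) (T + 1))).
assert (Hm : forall x, Rmax 1 (Rmax (c + 1) (T + 1)) <= x -> 1 <= x /\ c < x /\ T < x).
{ intros x Hx; pose proof (Rmax_l 1 (Rmax (c + 1) (T + 1))).
  pose proof (Rmax_r 1 (Rmax (c + 1) (T + 1))).
  pose proof (Rmax_l (c + 1) (T + 1)); pose proof (Rmax_r (c + 1) (T + 1)); lra. }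
split; [apply Rmax_l|]; intros a b [Ha Hab].
destruct (HE b) as [s Hs].
assert (V : (rho a - l / 2) * ln a <= (rho b - l / 2) * ln b); [|lra].
apply (nondecreasing_except_finite s (fun x => (rho x - l / 2) * ln x)); [assumption| |].
- intros x Hx; destruct (Hm x ltac:(lra)) as [X1 [X2 X3]].
  apply (continuous_mult (K := R_AbsRing)).
  + apply (continuous_minus (V := R_NormedModule)); [now apply Hcont | apply continuous_const].
  + apply continuous_ln; lra.
- intros x Hx N; destruct (Hm x ltac:(lra)) as [X1 [X2 X3]].
  assert (NE : ~ E x) by (intros Ex; apply N, Hs; [lra | assumption]).
  destruct (HT x X3) as [A1 A2]; specialize (A2 NE).
  destruct (Hder x X2 NE) as [D _]; apply Derive_correct in D.
  exists (Derive rho x * ln x + (rho x - l / 2) * / x); split.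
  + assert (D1 : is_derive (fun x => rho x - l / 2) x (Derive rho x)).
    { evar_last; [apply (is_derive_minus (V := R_NormedModule)); [exact D | apply is_derive_const] |].
      cbv [minus plus opp zero]; simpl; ring. }
    assert (D2 : is_derive ln x (/ x)) by (apply is_derive_ln; lra).
    evar_last; [apply (is_derive_mult (K := R_AbsRing)); [exact D1 | exact D2 | intros; apply Rmult_comm] |].
    cbv [plus mult]; simpl; ring.
  + replace (Derive rho x * ln x + (rho x - l / 2) * / x)
      with ((x * Derive rho x * ln x + (rho x - l / 2)) / x) by (field; lra).
    apply Rle_mult_inv_pos; lra.
Qed.

(** * Weights of a logarithmically convex sequence *)

Lemma quotients_nondecreasing M : (forall p, 0 < M p) -> log_convex M ->
  forall n k, quotients M n <= quotients M (k + n).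
Proof.
intros Mp Hlc n k; induction k as [|k IH]; [right; reflexivity|].
eapply Rle_trans; [exact IH|]; unfold quotients.
specialize (Hlc (S (k + n)) ltac:(lia)).
replace (S (k + n) - 1)%nat with (k + n)%nat in Hlc by lia.
replace (S k + n + 1)%nat with (S (k + n) + 1)%nat by lia.
replace (S k + n)%nat with (S (k + n)) by lia.
replace (k + n + 1)%nat with (S (k + n)) by lia.
pose proof (Mp (k + n)%nat) as H0; pose proof (Mp (S (k + n))) as H1.
apply (Rmult_le_reg_r (M (k + n)%nat * M (S (k + n)))); [now apply Rmult_lt_0_compat|].
replace (M (S (k + n)) / M (k + n)%nat * (M (k + n)%nat * M (S (k + n))))
  with (M (S (k + n)) ^ 2) by (field; lra).
replace (M (S (k + n) + 1)%nat / M (S (k + n)) * (M (k + n)%nat * M (S (k + n))))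
  with (M (k + n)%nat * M (S (k + n) + 1)%nat) by (field; lra).
exact Hlc.
Qed.

Lemma weights_succ M x n : (forall p, 0 < M p) ->
  M (S n) * x ^ S n = quotients M n * x * (M n * x ^ n).
Proof.
intros Mp; unfold quotients; replace (n + 1)%nat with (S n) by lia.
simpl; field; apply Rgt_not_eq, Mp.
Qed.

Lemma weights_pos M x n : (forall p, 0 < M p) -> 0 < x -> 0 < M n * x ^ n.
Proof. intros Mp Hx; apply Rmult_lt_0_compat; [apply Mp | now apply pow_lt]. Qed.

Lemma weights_nondecreasing M x p : (forall p, 0 < M p) -> log_convex M -> 0 < x ->
  1 <= quotients M p * x ->
  forall m n, (p <= m <= n)%nat -> M m * x ^ m <= M n * x ^ n.
Proof.
intros Mp Hlc Hx Hp m n [Hm Hn].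
induction Hn as [|n Hn IH]; [right; reflexivity|].
eapply Rle_trans; [exact IH|]; rewrite weights_succ by assumption.
assert (quotients M p <= quotients M n).
{ replace n with (n - p + p)%nat by lia; now apply quotients_nondecreasing. }
assert (quotients M p * x <= quotients M n * x) by (apply Rmult_le_compat_r; lra).
pose proof (weights_pos M x n Mp Hx); nra.
Qed.

(** Consecutive weights have ratio [quotients M n * x], which is nondecreasing in [n] and unbounded;
    the bottom of the valley is the first index at which this ratio reaches 1. *)
Lemma weights_valley M x : (forall p, 0 < M p) -> log_convex M ->
  is_lim_seq (quotients M) p_infty -> 0 < x ->
  exists p : nat,
    (forall m n, (m <= n <= p)%nat -> M n * x ^ n <= M m * x ^ m) /\
    (forall m n, (p <= m <= n)%nat -> M m * x ^ m <= M n * x ^ n).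
Proof.
intros Mp Hlc Hlim Hx.
assert (Hex : exists n, 1 <= quotients M n * x).
{ apply is_lim_seq_spec in Hlim; destruct (Hlim (/ x)) as [n Hn].
  exists n; specialize (Hn n (le_n n)).
  apply (Rmult_le_reg_r (/ x)); [now apply Rinv_0_lt_compat|].
  rewrite Rmult_assoc, Rinv_r; lra. }
assert (Hmin : exists p, 1 <= quotients M p * x /\ forall n, (n < p)%nat -> quotients M n * x < 1).
{ destruct Hex as [n Hn]; revert Hn; induction n as [n IH] using lt_wf_ind.
  intros Hn; destruct (classic (exists m, (m < n)%nat /\ 1 <= quotients M m * x)) as [[m [Hm1 Hm2]]|N].
  - exact (IH m Hm1 Hm2).
  - exists n; split; [exact Hn|]; intros m Hm; apply Rnot_le_lt; intros H; apply N; eauto. }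
destruct Hmin as [p [Hp1 Hp2]]; exists p; split; intros m n [Hm Hn].
- induction Hm as [|n Hm IH]; [right; reflexivity|].
  eapply Rle_trans; [|apply IH; lia]; rewrite weights_succ by assumption.
  specialize (Hp2 n ltac:(lia)); pose proof (weights_pos M x n Mp Hx); nra.
- now apply (weights_nondecreasing M x p).
Qed.

(** The quantity [t^n / M n] at [t = 1 / x] is the inverse of the weight of index [n]. Here the
    function controlled by the proximate order meets the minimising index. *)
Lemma assoc_fun_inv M x p : (forall p, 0 < M p) -> 0 < x ->
  (forall n, M p * x ^ p <= M n * x ^ n) -> assoc_fun M (/ x) = - ln (M p * x ^ p).
Proof.
intros Mp Hx Hmin.
assert (Hpos : forall n, 0 < M n * x ^ n) by (intros n; now apply weights_pos).
assert (Ht : forall n, ln ((/ x) ^ n / M n) = - ln (M n * x ^ n)).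
{ intros n; rewrite <- ln_Rinv by apply Hpos; f_equal.
  rewrite pow_inv; field; split; apply Rgt_not_eq; [now apply pow_lt | apply Mp]. }
unfold assoc_fun.
rewrite (is_sup_seq_unique _ (Finite (- ln (M p * x ^ p)))); [reflexivity|].
intros e; pose proof (cond_pos e); split.
- intros n; simpl; rewrite Ht.
  specialize (Hmin n); apply ln_le in Hmin; [lra | apply Hpos].
- exists p; simpl; rewrite Ht; lra.
Qed.

(* A form of moderate growth of [M]; the only consequence of the proximate
   order that the propagation needs. *)
Lemma weights_power_bound M : (forall p, 0 < M p) -> log_convex M ->
  is_lim_seq (quotients M) p_infty -> admits_nonzero_proximate_order M ->
  forall omega, 0 < omega -> exists B x0, 1 <= B /\ 0 < x0 /\
    forall x p, 0 < x <= x0 -> (forall n, M p * x ^ p <= M n * x ^ n) ->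
    forall q, omega * ln (M p * x ^ p) <= ln (M q * (B * x) ^ q).
Proof.
intros Mp Hlc Hlim [rho [l [A [A' [Hrho [Hl [T HT]]]]]]] omega Hom.
destruct (proximate_order_growth rho l Hrho Hl) as [t1 [Ht1 Hgrow]].
(* Dilating [t] by [exp b] multiplies [t^rho(t)] by at least [exp (l / 2 * b)]. This must outweigh
   both [1 / omega] and the factor [exp (A' - A)] lost in comparing [t^rho(t)] with
   [assoc_fun M t]. *)
set (b := Rmax 0 (2 / l * (A' - A - ln omega))).
set (B := exp b).
assert (Hb : 0 <= b) by apply Rmax_l.
assert (Hb' : A' - A - ln omega <= l / 2 * b).
{ replace (A' - A - ln omega) with (l / 2 * (2 / l * (A' - A - ln omega))) by (field; lra).
  apply Rmult_le_compat_l; [lra | apply Rmax_r]. }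
assert (HB : 1 <= B) by (unfold B; rewrite <- exp_0; now apply exp_nondecreasing).
(* The bound by [M 1] makes the weight of index 1, hence the minimal one, less than 1. Then
   [assoc_fun M t] is positive, and the logarithm in [d_fun] is a true one. *)
set (t0 := Rmax (t1 + 1) (Rmax (T + 1) (M 1%nat + 1))).
assert (Ht0 : t1 + 1 <= t0 /\ T + 1 <= t0 /\ M 1%nat + 1 <= t0).
{ unfold t0; pose proof (Rmax_l (t1 + 1) (Rmax (T + 1) (M 1%nat + 1))).
  pose proof (Rmax_r (t1 + 1) (Rmax (T + 1) (M 1%nat + 1))).
  pose proof (Rmax_l (T + 1) (M 1%nat + 1)); pose proof (Rmax_r (T + 1) (M 1%nat + 1)); lra. }
assert (Hasc : forall t p, t0 <= t -> (forall n, M p * (/ t) ^ p <= M n * (/ t) ^ n) ->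
   0 < - ln (M p * (/ t) ^ p) /\
   A <= rho t * ln t - ln (- ln (M p * (/ t) ^ p)) <= A').
{ intros t p Ht Hp.
  assert (0 < / t) by (apply Rinv_0_lt_compat; lra).
  assert (Hln : 0 < ln t) by (rewrite <- ln_1; apply ln_increasing; lra).
  pose proof (assoc_fun_inv M (/ t) p Mp ltac:(assumption) Hp) as E; rewrite Rinv_inv in E.
  specialize (HT t ltac:(lra)); unfold d_fun in HT; rewrite E in HT.
  replace (ln t * (rho t - ln (- ln (M p * (/ t) ^ p)) / ln t))
    with (rho t * ln t - ln (- ln (M p * (/ t) ^ p))) in HT by (field; lra).
  split; [|exact HT].
  assert (M p * (/ t) ^ p < 1).
  { eapply Rle_lt_trans; [apply (Hp 1%nat)|]; rewrite pow_1.
    apply (Rmult_lt_reg_r t); [lra|]; rewrite Rmult_assoc, Rinv_l; lra. }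
  rewrite <- Ropp_0, <- ln_1; apply Ropp_lt_contravar, ln_increasing; [now apply weights_pos | assumption]. }
exists B, (/ (B * t0)); split; [exact HB|]; split; [apply Rinv_0_lt_compat; nra|].
intros x p [Hx0 Hx] Hp q.
assert (HBx : 0 < B * x) by nra.
destruct (weights_valley M (B * x) Mp Hlc Hlim HBx) as [p' [V1 V2]].
assert (Hp' : forall n, M p' * (B * x) ^ p' <= M n * (B * x) ^ n).
{ intros n; destruct (Nat.le_ge_cases n p'); [apply V1 | apply V2]; lia. }
assert (Ht' : t0 <= / (B * x)).
{ rewrite <- (Rinv_inv t0); apply Rinv_le_contravar; [assumption|].
  apply (Rmult_le_compat_l B) in Hx; [|lra].
  rewrite Rinv_mult, <- Rmult_assoc, Rinv_r in Hx by lra; lra. }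
assert (Ht : / (B * x) <= / x) by (apply Rinv_le_contravar; nra).
destruct (Hasc (/ (B * x)) p') as [N1 N2]; [lra | rewrite Rinv_inv; exact Hp' |].
destruct (Hasc (/ x) p) as [N3 N4]; [lra | rewrite Rinv_inv; exact Hp |].
rewrite Rinv_inv in N1, N2, N3, N4.
specialize (Hgrow (/ (B * x)) (/ x) ltac:(lra)).
replace (ln (/ x) - ln (/ (B * x))) with b in Hgrow.
2: { rewrite !ln_Rinv, ln_mult by lra; unfold B; rewrite ln_exp; ring. }
(* In terms of [assoc_fun] this says that its value at [1 / (B * x)] is at most [omega] times its
   value at [1 / x]. Taking logarithms of the negation contradicts [N2], [N4], [Hgrow] and the
   choice of [b]. *)
assert (Hle : - ln (M p' * (B * x) ^ p') <= omega * - ln (M p * x ^ p)).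
{ apply Rnot_lt_le; intros Hlt; apply ln_increasing in Hlt; [|nra].
  rewrite ln_mult in Hlt by assumption; lra. }
assert (ln (M p' * (B * x) ^ p') <= ln (M q * (B * x) ^ q)); [|lra].
apply ln_le; [now apply weights_pos | apply Hp'].
Qed.

(** * Propagation of the expansion *)

Lemma partial_sum_S a p z : partial_sum a (S p) z = (partial_sum a p z + a p * z ^ p)%C.
Proof.
destruct p as [|p].
- change (sum_n (fun n => (a n * z ^ n)%C) 0 = (0 + a 0%nat * z ^ 0)%C).
  rewrite sum_O; change (a 0%nat * z ^ 0 = 0 + a 0%nat * z ^ 0)%C; ring.
- exact (sum_Sn (fun n => (a n * z ^ n)%C) p).
Qed.

Lemma partial_sum_diff a z X p q : (p <= q)%nat -> 0 <= X ->
  (forall n, (p <= n < q)%nat -> Cmod (a n * z ^ n) <= X * (/ 2) ^ n) ->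
  Cmod (partial_sum a q z - partial_sum a p z) <= 2 * X.
Proof.
intros Hpq HX H.
assert (HI : Cmod (partial_sum a q z - partial_sum a p z) <= X * (2 * (/ 2) ^ p - 2 * (/ 2) ^ q)).
{ induction Hpq as [|q Hpq IH].
  - unfold Cminus; rewrite Cplus_opp_r, Cmod_0; lra.
  - rewrite partial_sum_S.
    replace (partial_sum a q z + a q * z ^ q - partial_sum a p z)%C
      with ((partial_sum a q z - partial_sum a p z) + a q * z ^ q)%C by ring.
    eapply Rle_trans; [apply Cmod_triangle|].
    specialize (IH ltac:(intros n Hn; apply H; lia)).
    specialize (H q ltac:(lia)); simpl pow; lra. }
assert (0 < (/ 2) ^ q) by (apply pow_lt; lra).
assert ((/ 2) ^ p <= 1) by (rewrite <- (pow1 p); apply pow_incr; lra).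
nra.
Qed.

Lemma Cdifferentiable_ext F G z : (forall w, F w = G w) -> Cdifferentiable F z -> Cdifferentiable G z.
Proof.
intros E [phi [Hc Hl]]; exists phi; split; [assumption|].
revert Hl; apply filter_imp; intros w; now rewrite !E.
Qed.

Lemma Cdifferentiable_partial_sum a p z : Cdifferentiable (partial_sum a p) z.
Proof.
induction p as [|p IH]; [apply (Cdifferentiable_const 0%C)|].
apply (Cdifferentiable_ext (fun w => partial_sum a p w + a p * w ^ p)%C).
- intros w; symmetry; apply partial_sum_S.
- apply Cdifferentiable_plus; [exact IH|].
  apply Cdifferentiable_mult; [apply Cdifferentiable_const | apply Cdifferentiable_pow, Cdifferentiable_id].
Qed.

Lemma remainder_bound_mono M f a K A K' A' z : (forall p, 0 < M p) ->
  0 <= K <= K' -> 0 <= A <= A' ->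
  remainder_bound M f a K A z -> remainder_bound M f a K' A' z.
Proof.
intros Mp HK HA H p; eapply Rle_trans; [apply H|].
assert (0 <= A ^ p <= A' ^ p) by (split; [now apply pow_le | now apply pow_incr]).
apply Rmult_le_compat_r; [apply pow_le; left; apply exp_pos|].
apply Rmult_le_compat_r; [left; apply Mp|].
apply Rmult_le_compat; lra.
Qed.

(** The term of index [p] is the difference of two consecutive remainders. At modulus at most
    [1 / (A * quotients M p)] the bound of the second does not exceed that of the first, so a single
    point yields the factor 2. *)
Lemma coefficient_bound M f a K A r theta : (forall p, 0 < M p) -> 0 < r -> 0 < K -> 0 < A ->
  (forall z : log_surface, arg z = theta -> modulus z <= r -> remainder_bound M f a K A z) ->
  forall p, Cmod (a p) <= 2 * K * A ^ p * M p.
Proof.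
intros Mp Hr HK HA H p.
assert (Hq : 0 < quotients M p).
{ unfold quotients; apply Rdiv_lt_0_compat; apply Mp. }
set (s := Rmin r (/ (A * quotients M p))).
assert (Hs : 0 < s).
{ apply Rmin_pos; [assumption|]; apply Rinv_0_lt_compat; now apply Rmult_lt_0_compat. }
assert (Hs1 : s <= r) by apply Rmin_l.
assert (Hs2 : A * quotients M p * s <= 1).
{ assert (HAq : 0 < A * quotients M p) by now apply Rmult_lt_0_compat.
  apply Rle_trans with (A * quotients M p * / (A * quotients M p)).
  - apply Rmult_le_compat_l; [lra | apply Rmin_r].
  - right; field; split; apply Rgt_not_eq; assumption. }
set (z := (ln s, theta) : log_surface).
assert (Hz : modulus z = s) by now apply exp_ln.
pose proof (H z eq_refl ltac:(lra) p) as B1.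
pose proof (H z eq_refl ltac:(lra) (S p)) as B2.
rewrite Hz in B1, B2.
assert (HMS : M (S p) = quotients M p * M p).
{ unfold quotients; replace (p + 1)%nat with (S p) by lia; field; apply Rgt_not_eq, Mp. }
assert (Hsp : 0 < s ^ p) by now apply pow_lt.
assert (HAp : 0 < A ^ p) by now apply pow_lt.
pose proof (Mp p) as HMp.
assert (Hsum : Cmod (a p * proj z ^ p) <= 2 * (K * A ^ p * M p * s ^ p)).
{ replace (a p * proj z ^ p)%C with
    ((f z - partial_sum a p (proj z)) + - (f z - partial_sum a (S p) (proj z)))%C
    by (rewrite partial_sum_S; ring).
  eapply Rle_trans; [apply Cmod_triangle|]; rewrite Cmod_opp.
  assert (K * A ^ S p * M (S p) * s ^ S p <= K * A ^ p * M p * s ^ p); [|lra].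
  rewrite HMS; simpl.
  replace (K * (A * A ^ p) * (quotients M p * M p) * (s * s ^ p))
    with ((A * quotients M p * s) * (K * A ^ p * M p * s ^ p)) by ring.
  assert (0 < K * A ^ p * M p * s ^ p) by (repeat apply Rmult_lt_0_compat; assumption).
  nra. }
rewrite Cmod_mult, Cmod_pow, Cmod_proj in Hsum.
change (exp (fst z)) with (modulus z) in Hsum; rewrite Hz in Hsum.
apply (Rmult_le_reg_r (s ^ p)); [assumption | lra].
Qed.

Lemma term_bound M (a : nat -> C) K A x (z : C) n : 0 < K -> 0 < A -> 0 < M n ->
  Cmod (a n) <= 2 * K * A ^ n * M n -> 2 * A * exp (fst z) <= x ->
  Cmod (a n * proj z ^ n) <= 2 * K * (M n * x ^ n) * (/ 2) ^ n.
Proof.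
intros HK HA HM Ha Hx.
rewrite Cmod_mult, Cmod_pow, Cmod_proj.
pose proof (exp_pos (fst z)) as He.
apply Rle_trans with (2 * K * A ^ n * M n * exp (fst z) ^ n).
- apply Rmult_le_compat_r; [apply pow_le; lra | assumption].
- replace (2 * K * A ^ n * M n * exp (fst z) ^ n)
    with (2 * K * (M n * (2 * A * exp (fst z)) ^ n) * (/ 2) ^ n).
  + apply Rmult_le_compat_r; [apply pow_le; lra|].
    apply Rmult_le_compat_l; [lra|]; apply Rmult_le_compat_l; [lra|].
    apply pow_incr; split; [|assumption].
    apply Rmult_le_pos; lra.
  + rewrite !Rpow_mult_distr, pow_inv; field; apply pow_nonzero; lra.
Qed.

Lemma remainder_bound_bounded M f a K A K1 U R0 : (forall p, 0 < M p) -> M 0%nat = 1 ->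
  log_convex M -> 0 < K -> 0 < A -> (forall n, Cmod (a n) <= 2 * K * A ^ n * M n) ->
  exists K' A', 0 < K' /\ 0 < A' /\
    forall z : log_surface, U <= fst z -> modulus z <= R0 -> Cmod (f z) <= K1 ->
      remainder_bound M f a K' A' z.
Proof.
intros Mp M0 Hlc HK HA Ha.
assert (Hq : 0 < quotients M 0) by (unfold quotients; apply Rdiv_lt_0_compat; apply Mp).
set (x := Rmax (2 * A * R0) (/ quotients M 0)).
assert (Hx0 : / quotients M 0 <= x) by apply Rmax_r.
assert (Hx : 0 < x) by (apply (Rlt_le_trans _ (/ quotients M 0)); [now apply Rinv_0_lt_compat | exact Hx0]).
assert (Hx1 : 1 <= quotients M 0 * x).
{ apply (Rmult_le_compat_l (quotients M 0)) in Hx0; [|lra].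
  rewrite Rinv_r in Hx0; lra. }
pose proof (weights_nondecreasing M x 0 Mp Hlc Hx Hx1) as Hmono.
exists (Rabs K1 + 4 * K), (x * exp (- U)).
pose proof (Rabs_pos K1); pose proof (exp_pos (- U)).
split; [lra|]; split; [nra|].
intros z HU HR HfK q.
pose proof (weights_pos M x q Mp Hx) as Hw.
assert (Hw1 : 1 <= M q * x ^ q).
{ specialize (Hmono 0%nat q ltac:(lia)); rewrite M0 in Hmono; simpl in Hmono; lra. }
assert (HS : Cmod (partial_sum a q (proj z) - partial_sum a 0 (proj z)) <= 2 * (2 * K * (M q * x ^ q))).
{ apply partial_sum_diff; [lia | nra |]; intros n Hn.
  eapply Rle_trans; [apply (term_bound M a K A x); auto|].
  - eapply Rle_trans; [|apply Rmax_l]; apply Rmult_le_compat_l; [lra | exact HR].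
  - apply Rmult_le_compat_r; [apply pow_le; lra|].
    apply Rmult_le_compat_l; [lra | apply Hmono; lia]. }
simpl partial_sum at 2 in HS.
apply Rle_trans with ((Rabs K1 + 4 * K) * (M q * x ^ q)).
- replace (f z - partial_sum a q (proj z))%C
    with (f z + - (partial_sum a q (proj z) - 0))%C by ring.
  eapply Rle_trans; [apply Cmod_triangle|]; rewrite Cmod_opp.
  assert (Cmod (f z) <= Rabs K1) by (eapply Rle_trans; [exact HfK | apply Rle_abs]).
  nra.
- replace ((Rabs K1 + 4 * K) * (x * exp (- U)) ^ q * M q * modulus z ^ q)
    with ((Rabs K1 + 4 * K) * (M q * (x * (exp (- U) * modulus z)) ^ q))
    by (rewrite !Rpow_mult_distr; ring).
  apply Rmult_le_compat_l; [lra|]; apply Rmult_le_compat_l; [left; apply Mp|].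
  apply pow_incr; split; [lra|].
  rewrite <- (Rmult_1_r x) at 1; apply Rmult_le_compat_l; [lra|].
  unfold modulus; rewrite <- exp_plus, <- exp_0; apply exp_nondecreasing; lra.
Qed.

Lemma remainder_bound_strip M f a K A theta b b0 U0 K0 :
  (forall p, 0 < M p) -> M 0%nat = 1 -> log_convex M ->
  is_lim_seq (quotients M) p_infty -> admits_nonzero_proximate_order M ->
  0 < K -> 0 < A -> (forall n, Cmod (a n) <= 2 * K * A ^ n * M n) ->
  Rabs theta <= b0 < b ->
  (forall u v, u <= U0 -> Rabs v <= b -> Cdifferentiable f (u, v) /\ Cmod (f (u, v)) <= K0) ->
  (forall u, u <= U0 -> remainder_bound M f a K A (u, theta)) ->
  exists U1 K' A', 0 < K' /\ 0 < A' /\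
    forall u v, u <= U1 -> Rabs v <= b0 -> remainder_bound M f a K' A' (u, v).
Proof.
intros Mp M0 Hlc Hlim Hprox HK HA Ha [Hth Hb] Hf Hray.
assert (Hb0 : 0 <= b0) by (eapply Rle_trans; [apply Rabs_pos | exact Hth]).
apply Rabs_le_between in Hth.
(* The rectangles used below have height at most [2 * b] and half-width twice their height. *)
set (L := 4 * b).
(* This is the exponent of [two_constants] in the worst case: the distance from [v] to the far side
   is at least [b - b0], and the height is at most [2 * b]. *)
set (omega := 3 / 4 * ((b - b0) / (2 * b))).
assert (Hom : 0 < omega).
{ unfold omega; apply Rmult_lt_0_compat; [lra|]; apply Rdiv_lt_0_compat; lra. }
destruct (weights_power_bound M Mp Hlc Hlim Hprox omega Hom) as [B [x0 [HB [Hx0 Hmg]]]].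
assert (HK0 : 0 <= K0).
{ eapply Rle_trans; [apply Cmod_ge_0 | apply (Hf U0 0); [lra | rewrite Rabs_R0; lra]]. }
pose proof (exp_pos L) as HeL.
(* The first bound keeps the rectangle around [u] inside the half-strip, the second one gives
   [x <= x0]. *)
set (U1 := Rmin (U0 - L) (ln (x0 / (2 * A * exp L)))).
(* [K0 + 4 * K] serves the remainder of index [p], the other [4 * K] the passage from [p] to [q]. *)
exists U1, (K0 + 4 * K + 4 * K), (B * (2 * A * exp L)).
split; [lra|]; split; [repeat apply Rmult_lt_0_compat; lra|].
intros u v Hu Hv q.
assert (Hu1 : u + L <= U0).
{ apply Rle_trans with (r2 := U0 - L + L); [|lra].
  apply Rplus_le_compat_r; eapply Rle_trans; [exact Hu | apply Rmin_l]. }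
(* [x] exceeds [2 * A] times the modulus throughout the rectangle; the factor 2 is the source of the
   geometric decay of the terms. *)
set (x := 2 * A * exp L * exp u).
assert (Hx : 0 < x) by (unfold x; pose proof (exp_pos u); repeat apply Rmult_lt_0_compat; lra).
assert (Hxx0 : x <= x0).
{ assert (0 < 2 * A * exp L) by (repeat apply Rmult_lt_0_compat; lra).
  assert (E : exp u <= x0 / (2 * A * exp L)).
  { rewrite <- (exp_ln (x0 / (2 * A * exp L))) by now apply Rdiv_lt_0_compat.
    apply exp_nondecreasing; eapply Rle_trans; [exact Hu | apply Rmin_r]. }
  apply (Rmult_le_compat_l (2 * A * exp L)) in E; [|lra].
  unfold x; eapply Rle_trans; [exact E | right; field; lra]. }
assert (HxL : forall w, w <= u + L -> 2 * A * exp w <= x).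
{ intros w Hw; unfold x; rewrite !Rmult_assoc, <- exp_plus.
  do 2 (apply Rmult_le_compat_l; [lra|]); apply exp_nondecreasing; lra. }
destruct (weights_valley M x Mp Hlc Hlim Hx) as [p [V1 V2]].
assert (Hmin : forall n, M p * x ^ p <= M n * x ^ n).
{ intros n; destruct (Nat.le_ge_cases n p); [apply V1 | apply V2]; lia. }
set (eta := M p * x ^ p) in *.
assert (Heta0 : 0 < eta) by now apply weights_pos.
assert (Heta1 : eta <= 1) by (specialize (Hmin 0%nat); rewrite M0 in Hmin; simpl in Hmin; lra).
set (F := fun w => (f w - partial_sum a p (proj w))%C).
assert (Hp : Cmod (F (u, v)) <= (K0 + 4 * K) * (M q * (B * x) ^ q)).
{ assert (Hgen : forall e t, e <> 0 -> 2 * Rabs e <= L -> 0 <= t <= 1 -> v = theta + e * t ->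
    (b - b0) / (2 * b) <= 1 - t ->
    (forall s, 0 <= s <= 1 -> Rabs (theta + e * s) <= b) ->
    Cmod (F (u, v)) <= (K0 + 4 * K) * (M q * (B * x) ^ q)).
  { intros e t He HeL2 Ht -> Ht' Hin.
    eapply Rle_trans.
    - apply (two_constants F u theta e (K0 + 4 * K) eta He (conj Heta0 Heta1)); [| | exact Ht].
      + intros w s Hw Hs; apply Rabs_le_between in Hw.
        destruct (Hf w (theta + e * s) ltac:(lra) (Hin s Hs)) as [D1 D2]; split.
        * unfold F, Cminus; apply Cdifferentiable_plus; [exact D1|].
          apply (Cdifferentiable_ext (fun z => - (1) * partial_sum a p (proj z))%C); [intros; ring|].
          apply Cdifferentiable_mult; [apply Cdifferentiable_const|].
          apply (Cdifferentiable_comp (partial_sum a p));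
            [apply Cdifferentiable_proj | apply Cdifferentiable_partial_sum].
        * unfold F; set (z := (w, theta + e * s) : C) in *.
          (* All weights of index up to [p] are at most the weight [M 0 = 1] of index 0, so the
             partial sum stays bounded although [p] grows without limit near the vertex. *)
          assert (HS : Cmod (partial_sum a p (proj z) - partial_sum a 0 (proj z)) <= 2 * (2 * K * 1)).
          { apply partial_sum_diff; [lia | lra |]; intros n Hn.
            eapply Rle_trans; [apply (term_bound M a K A x); auto; apply HxL; simpl; lra|].
            apply Rmult_le_compat_r; [apply pow_le; lra|].
            apply Rmult_le_compat_l; [lra|].
            specialize (V1 0%nat n ltac:(lia)); rewrite M0 in V1; simpl in V1; lra. }
          simpl partial_sum at 2 in HS.
          replace (f z - partial_sum a p (proj z))%C
            with (f z + - (partial_sum a p (proj z) - 0))%C by ring.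
          eapply Rle_trans; [apply Cmod_triangle|]; rewrite Cmod_opp; lra.
      + intros w Hw; apply Rabs_le_between in Hw.
        eapply Rle_trans; [apply (Hray w ltac:(lra) p)|].
        apply Rle_trans with (K * eta); [|nra].
        unfold eta, modulus; simpl fst.
        rewrite Rmult_assoc, Rmult_assoc; apply Rmult_le_compat_l; [lra|].
        rewrite Rmult_comm, Rmult_assoc; apply Rmult_le_compat_l; [left; apply Mp|].
        rewrite <- Rpow_mult_distr; apply pow_incr.
        pose proof (exp_pos w); specialize (HxL w ltac:(lra)).
        split; nra.
    - apply Rmult_le_compat_l; [lra|].
      rewrite <- (exp_ln (M q * (B * x) ^ q)) by (apply weights_pos; nra || assumption).
      apply exp_nondecreasing.
      eapply Rle_trans; [|apply (Hmg x p (conj Hx Hxx0) Hmin q)]; fold eta.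
      assert (ln eta <= 0) by (rewrite <- ln_1; now apply ln_le).
      assert (omega <= 3 / 4 * (1 - t)) by (unfold omega; lra).
      nra. }
  apply Rabs_le_between in Hv.
  assert (Hratio : forall e r, 0 < e <= 2 * b -> b - b0 <= r -> (b - b0) / (2 * b) <= r / e).
  { intros e r He Hr; unfold Rdiv; apply Rmult_le_compat; [lra | | exact Hr |].
    - left; apply Rinv_0_lt_compat; lra.
    - apply Rinv_le_contravar; lra. }
  destruct (Rle_lt_dec theta v) as [Hvt|Hvt].
  - apply (Hgen (b - theta) ((v - theta) / (b - theta))).
    + lra.
    + unfold L; rewrite Rabs_pos_eq; lra.
    + split; [apply Rle_mult_inv_pos; lra|].
      apply (Rmult_le_reg_r (b - theta)); [lra|].
      unfold Rdiv; rewrite Rmult_assoc, Rinv_l; lra.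
    + field; lra.
    + replace (1 - (v - theta) / (b - theta)) with ((b - v) / (b - theta)) by (field; lra).
      apply Hratio; lra.
    + intros s Hs; apply Rabs_le; nra.
  - apply (Hgen (- (b + theta)) ((theta - v) / (b + theta))).
    + lra.
    + unfold L; rewrite Rabs_Ropp, Rabs_pos_eq; lra.
    + split; [apply Rle_mult_inv_pos; lra|].
      apply (Rmult_le_reg_r (b + theta)); [lra|].
      unfold Rdiv; rewrite Rmult_assoc, Rinv_l; lra.
    + field; lra.
    + replace (1 - (theta - v) / (b + theta)) with ((b + v) / (b + theta)) by (field; lra).
      apply Hratio; lra.
    + intros s Hs; apply Rabs_le; nra. }
set (z := (u, v) : C) in *.
assert (Hterm : forall n, M n * x ^ n <= M q * x ^ q ->
  Cmod (a n * proj z ^ n) <= 2 * K * (M q * x ^ q) * (/ 2) ^ n).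
{ intros n Hn; eapply Rle_trans; [apply (term_bound M a K A x); auto; apply HxL; simpl; unfold L; lra|].
  apply Rmult_le_compat_r; [apply pow_le; lra|]; apply Rmult_le_compat_l; lra. }
pose proof (weights_pos M x q Mp Hx) as Hwq.
(* On both sides of the valley, every index between [p] and [q] has a weight at most that of [q]. *)
assert (Hd : Cmod (partial_sum a p (proj z) - partial_sum a q (proj z)) <= 4 * K * (M q * x ^ q)).
{ replace (4 * K * (M q * x ^ q)) with (2 * (2 * K * (M q * x ^ q))) by ring.
  destruct (Nat.le_ge_cases q p) as [E|E].
  - apply partial_sum_diff; [exact E | nra |]; intros n Hn; apply Hterm, V1; lia.
  - replace (partial_sum a p (proj z) - partial_sum a q (proj z))%C
      with (- (partial_sum a q (proj z) - partial_sum a p (proj z)))%C by ring.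
    rewrite Cmod_opp.
    apply partial_sum_diff; [exact E | nra |]; intros n Hn; apply Hterm, V2; lia. }
assert (HBx : M q * x ^ q <= M q * (B * x) ^ q).
{ apply Rmult_le_compat_l; [left; apply Mp|]; apply pow_incr; nra. }
replace (f z - partial_sum a q (proj z))%C
  with (F z + (partial_sum a p (proj z) - partial_sum a q (proj z)))%C by (unfold F; ring).
eapply Rle_trans; [apply Cmod_triangle|].
replace ((K0 + 4 * K + 4 * K) * (B * (2 * A * exp L)) ^ q * M q * modulus z ^ q)
  with ((K0 + 4 * K + 4 * K) * (M q * (B * x) ^ q)).
- assert (0 < M q * (B * x) ^ q) by lra; nra.
- unfold x; change (modulus z) with (exp u); rewrite !Rpow_mult_distr; ring.
Qed.

(** * Bounded sectors and their closures *)

Lemma closure_sector d g r (z : log_surface) : 0 < r -> closure (sector d g r) z ->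
  Rabs (arg z - d) <= PI * g / 2 /\ fst z <= ln r.
Proof.
intros Hr H.
assert (He : forall e, 0 < e -> Rabs (arg z - d) <= PI * g / 2 + e /\ fst z <= ln r + e).
{ intros e He; destruct (H _ (locally_ball z (mkposreal e He))) as [y [[B1 B2] [Y1 Y2]]].
  change (Rabs (fst y - fst z) < e) in B1; change (Rabs (snd y - snd z) < e) in B2.
  unfold arg in *; apply Rabs_def2 in B1; apply Rabs_def2 in B2; apply Rabs_def2 in Y1.
  unfold modulus in Y2; rewrite <- (exp_ln r Hr) in Y2; apply exp_lt_inv in Y2.
  split; [apply Rabs_le|]; lra. }
split; apply le_epsilon; intros e Hpos; now apply He.
Qed.

Lemma sector_edges_closure d g r s : 0 < g -> 0 < r -> s = 1 \/ s = -1 ->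
  closure (sector d g r) (ln (r / 2), d + s * (PI * g / 2)).
Proof.
intros Hg Hr Hs U [e He].
assert (Hh : 0 < PI * g / 2) by (pose proof PI_RGT_0; nra).
set (h := PI * g / 2) in *.
set (m := Rmin (e / 2) h).
assert (Hm : 0 < m) by (apply Rmin_pos; [pose proof (cond_pos e); lra | assumption]).
assert (Hm1 : m <= e / 2) by apply Rmin_l.
assert (Hm2 : m <= h) by apply Rmin_r.
exists (ln (r / 2), d + s * (h - m)); split.
- apply He; split; cbn [fst snd].
  + apply ball_center.
  + apply Rabs_def1; cbv [minus plus opp]; simpl; destruct Hs as [-> | ->]; lra.
- split; unfold arg, modulus; cbn [fst snd].
  + apply Rabs_def1; destruct Hs as [-> | ->]; fold h; lra.
  + rewrite exp_ln; lra.
Qed.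

Lemma proper_subsector_arg gamma T G : sectorial_region gamma G -> proper_subsector T G ->
  exists s r, s < PI * gamma / 2 /\ forall z, T z -> Rabs (arg z) <= s /\ modulus z <= r.
Proof.
intros [_ [_ [HG _]]] [[d [g [r [Hg [Hr HT]]]]] Hcl].
assert (Hedge : forall s, s = 1 \/ s = -1 -> Rabs (d + s * (PI * g / 2)) < PI * gamma / 2).
{ intros s Hs; pose proof (HG _ (Hcl (ln (r / 2), d + s * (PI * g / 2))
    ltac:(intros U HU; destruct (sector_edges_closure d g r s Hg Hr Hs U HU) as [y [Y1 Y2]];
          exists y; split; [exact Y1 | now apply HT]))) as A.
  unfold unbounded_sector, arg in A; simpl in A; rewrite Rminus_0_r in A; exact A. }
pose proof (Hedge 1 (or_introl eq_refl)) as E1; pose proof (Hedge (-1) (or_intror eq_refl)) as E2.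
apply Rabs_def2 in E1; apply Rabs_def2 in E2.
exists (Rmax (d + PI * g / 2) (- (d - PI * g / 2))), r; split.
- apply Rmax_lub_lt; lra.
- intros z Hz; apply HT in Hz; destruct Hz as [Z1 Z2]; apply Rabs_def2 in Z1; split; [|lra].
  pose proof (Rmax_l (d + PI * g / 2) (- (d - PI * g / 2))).
  pose proof (Rmax_r (d + PI * g / 2) (- (d - PI * g / 2))).
  apply Rabs_le; lra.
Qed.

Theorem theorem5p2 (M : nat -> R)
  (M_pos : forall p, 0 < M p)
  (M_0 : M 0%nat = 1)
  (M_log_convex : log_convex M)
  (M_quotients : is_lim_seq (quotients M) p_infty)
  (M_proximate : admits_nonzero_proximate_order M)
  (gamma : R) (gamma_pos : 0 < gamma)
  (G : log_surface -> Prop) (G_sectorial : sectorial_region gamma G)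
  (theta : R) (theta_range : - (PI * gamma / 2) < theta < PI * gamma / 2)
  (f : log_surface -> C) (f_holo : holomorphic_on G f)
  (f_bounded : forall T, proper_subsector T G -> bounded_on T f)
  (a : nat -> C) (f_direction : asymptotic_in_direction M G f a theta) :
  A_tilde M G f /\ asymptotic M G f a.
Proof.
assert (H : asymptotic M G f a); [|split; [split; [assumption | now exists a] | assumption]].
intros T HT; destruct (f_bounded T HT) as [KT HKT].
destruct (proper_subsector_arg gamma T G G_sectorial HT) as [s [RT [Hs HsT]]].
destruct f_direction as [r [K [A [Hr [HK [HA Hdir]]]]]].
assert (Ha : forall n, Cmod (a n) <= 2 * K * A ^ n * M n).
{ apply (coefficient_bound M f a K A r theta); auto; intros z H1 H2; now apply Hdir. }
(* The strip must contain both [T] and the direction [theta] from which the estimate spreads. *)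
set (b0 := Rmax s (Rabs theta)).
assert (Hb0 : b0 < PI * gamma / 2) by (apply Rmax_lub_lt; [assumption | now apply Rabs_def1]).
assert (Hb0th : Rabs theta <= b0) by apply Rmax_r.
assert (Hb0s : s <= b0) by apply Rmax_l.
assert (Hb0p : 0 <= b0) by (eapply Rle_trans; [apply Rabs_pos | exact Hb0th]).
(* Four nested half-angles: [b0] for the conclusion, [b0 + delta] for the rectangles,
   [b0 + 2 * delta] for the sector where [f] is bounded, [b0 + 3 * delta] for a sector inside [G]
   that contains the closure of the previous one. *)
set (delta := (PI * gamma / 2 - b0) / 4).
assert (Hdelta : 0 < delta) by (unfold delta; lra).
assert (HPI := PI_RGT_0).
assert (Hangle : forall y, PI * (2 * y / PI) / 2 = y) by (intros; field; lra).
destruct G_sectorial as [_ [_ [_ Hsect]]].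
destruct (Hsect (2 * (b0 + 3 * delta) / PI)) as [rho [Hrho HrhoG]].
{ split; [apply Rdiv_lt_0_compat; lra|].
  apply (Rmult_lt_reg_r PI); [lra|].
  unfold Rdiv; rewrite Rmult_assoc, Rinv_l by lra; unfold delta; lra. }
set (S1 := sector 0 (2 * (b0 + 2 * delta) / PI) (rho / 2)).
destruct (f_bounded S1) as [K0 HK0].
{ split.
  - exists 0, (2 * (b0 + 2 * delta) / PI), (rho / 2).
    split; [apply Rdiv_lt_0_compat; lra|]; split; [lra | intros z; reflexivity].
  - intros z Hz; apply closure_sector in Hz; [|lra]; destruct Hz as [Z1 Z2].
    rewrite Hangle in Z1; apply HrhoG; split; [rewrite Hangle; lra|].
    unfold modulus; apply Rle_lt_trans with (exp (ln (rho / 2))).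
    + now apply exp_nondecreasing.
    + rewrite exp_ln; lra. }
set (U0 := Rmin (ln (rho / 4)) (ln r)).
destruct (remainder_bound_strip M f a K A theta (b0 + delta) b0 U0 K0)
  as [U1 [K1 [A1 [HK1 [HA1 Hstrip]]]]]; try assumption.
- split; lra.
- intros u v Hu Hv.
  assert (Hm : exp u <= rho / 4).
  { rewrite <- (exp_ln (rho / 4)) by lra; apply exp_nondecreasing.
    eapply Rle_trans; [exact Hu | apply Rmin_l]. }
  split.
  + apply holomorphic_at_Cdifferentiable, f_holo, HrhoG; split; unfold arg, modulus; simpl.
    * rewrite Hangle, Rminus_0_r; lra.
    * lra.
  + apply HK0; split; unfold arg, modulus; simpl; [rewrite Hangle, Rminus_0_r|]; lra.
- intros u Hu; apply Hdir; [reflexivity|].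
  unfold modulus; simpl; rewrite <- (exp_ln r Hr); apply exp_nondecreasing.
  eapply Rle_trans; [exact Hu | apply Rmin_r].
(* The part of [T] beyond [U1] has modulus between [exp U1] and [RT], and there the bound of [f] on
   [T] itself is enough. *)
- destruct (remainder_bound_bounded M f a K A KT U1 RT) as [K2 [A2 [HK2 [HA2 Hfar]]]];
    try assumption.
  pose proof (Rmax_l K1 K2); pose proof (Rmax_r K1 K2).
  pose proof (Rmax_l A1 A2); pose proof (Rmax_r A1 A2).
  exists (Rmax K1 K2), (Rmax A1 A2); split; [lra|]; split; [lra|].
  intros z Hz; destruct (HsT z Hz) as [Z1 Z2]; destruct (Rle_lt_dec (fst z) U1) as [E|E].
  + apply (remainder_bound_mono M f a K1 A1); [assumption | lra | lra |].
    destruct z as [u v]; apply Hstrip; [exact E | unfold arg in Z1; simpl in Z1; lra].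
  + apply (remainder_bound_mono M f a K2 A2); [assumption | lra | lra |].
    apply Hfar; [lra | exact Z2 | now apply HKT].
Qed.
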